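(* For any number field $K$ the class ring $\mathcal{CL}_K$ (with the $\lambda$-ring structure induced from that of $A_K(\mathbb{Z})$) is a finitely generated $\lambda$-ring.
   Context: Let $K$ be a number field with ring of integers $\mathcal{O}_K$. $\mathbb{P}_K$ is the set of (nonzero) prime ideals of $\mathcal{O}_K$, $\mathcal{J}_K$ the group of fractional ideals. $\Lambda_{\mathbb{Z}}$ is the ring of symmetric functions over $\mathbb{Z}$. For each $\mathfrak{q}\in\mathbb{P}_K$ let $\mathfrak{X}^{(\mathfrak{q})}=x_1^{(\mathfrak{q})}+x_2^{(\mathfrak{q})}+\cdots$ be a set of commuting free variables and let $A_K(\mathbb{Z}):=\bigotimes_{\mathfrak{q}\in\mathbb{P}_K}\Lambda_{\mathbb{Z}}[\mathfrak{X}^{(\mathfrak{q})}]$ (direct limit of tensor products over finite subsets of $\mathbb{P}_K$). The ring $A_K(\mathbb{Z})$ is a $\lambda$-ring via plethysm: the power-sum (Adams) operations are $p_r:x_i^{(\mathfrak{q})}\mapsto (x_i^{(\mathfrak{q})})^r$ for all $r\ge1$, and the operations $F\mapsto h_r[F]$ are obtained by expanding the complete homogeneous symmetric function $h_r$ in power sums (the result has integral coefficients). For $\mathfrak{a}\in\mathcal{J}_K$ write $\mathfrak{a}=\prod_{\mathfrak{q}}\mathfrak{q}^{\nu_{\mathfrak{q}}(\mathfrak{a})}$ and define $H^{(m)}_{\mathfrak{a}}:=h_m\left[\sum_{\mathfrak{q}}\nu_{\mathfrak{q}}(\mathfrak{a})\mathfrak{X}^{(\mathfrak{q})}\right]\in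 A_K(\mathbb{Z})$ for $m\ge 0$; concretely it is the homogeneous component of total degree $m$ of $\prod_{\mathfrak{q}}\prod_{i\ge1}(1-x_i^{(\mathfrak{q})})^{-\nu_{\mathfrak{q}}(\mathfrak{a})}$. Let $\mathcal{P}_K\subset A_K(\mathbb{Z})$ be the ideal generated by all $H^{(m)}_{(\alpha)}$ with $m\ge1$ and $\alpha\in K^*$, where $(\alpha)$ is the principal fractional ideal generated by $\alpha$. The class ring is $\mathcal{CL}_K:=A_K(\mathbb{Z})/\mathcal{P}_K$. Finitely generated as a $\lambda$-ring means that there are finitely many elements such that the smallest subring containing them and closed under all the $\lambda$-operations (equivalently all $h_r$) is the whole ring. *)

(* Defs.v *)
From HB Require Import structures.
From mathcomp Require Import all_boot all_order all_algebra all_field.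
From mathcomp Require Import finmap.
From mathcomp Require Import boolp classical_sets functions.
From mathcomp Require Import monalg mpoly.

Set Implicit Arguments.
Unset Strict Implicit.
Unset Printing Implicit Defensive.

Import GRing.Theory Num.Theory.

Local Open Scope ring_scope.
Local Open Scope classical_set_scope.

Section Generated.
Variable R : comNzRingType.
Implicit Types (G : set R) (S : {pred R}).

Definition generated_subring G : {pred R} := fun x =>
  `[< forall S, subring_closed S -> (forall g, G g -> g \in S) -> x \in S >].

(* [idealr_closed] of the library also requires [1 \notin S]. *)
Definition ideal_closed S :=
  zmod_closed S /\ forall a, {in S, forall u, a * u \in S}.

Definition generated_ideal G : {pred R} := fun x =>
  `[< forall S, ideal_closed S -> (forall g, G g -> g \in S) -> x \in S >].

Lemma generated_subring_closed G : subring_closed (generated_subring G).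
Proof.
split.
- by apply/asboolP => S [].
- move=> x y /asboolP hx /asboolP hy; apply/asboolP => S cS GS.
  by case: (cS) => _ cB _; apply: cB; [apply: hx | apply: hy].
- move=> x y /asboolP hx /asboolP hy; apply/asboolP => S cS GS.
  by case: (cS) => _ _ cM; apply: cM; [apply: hx | apply: hy].
Qed.

Lemma generated_ideal_closed G : ideal_closed (generated_ideal G).
Proof.
split; first split.
- by apply/asboolP => S [[]].
- move=> x y /asboolP hx /asboolP hy; apply/asboolP => S cS GS.
  by case: (cS) => [[_ cB] _]; apply: cB; [apply: hx | apply: hy].
- move=> a x /asboolP hx; apply/asboolP => S cS GS.
  by case: (cS) => [_ cM]; apply: cM; apply: hx.
Qed.

Lemma mem_generated_subring G x : G x -> x \in generated_subring G.
Proof. by move=> Gx; apply/asboolP => S _; apply. Qed.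

(* [h r] is the operation F |-> h_r[F]. *)
Definition finitely_generated_lambda (h : nat -> R -> R) :=
  exists gens : seq R, forall S,
    subring_closed S ->
    (forall r, {in S, forall x, h r x \in S}) ->
    {subset gens <= S} ->
    forall x, x \in S.

End Generated.

Section FractionalIdeals.
Variable K : fieldExtType rat.
Implicit Types I J p : set K.

Definition ring_of_integers : set K :=
  [set x | integralOver (intr : int -> K) x].
Local Notation OK := ring_of_integers.

Definition prime_ideal p :=
  [/\ p `<=` OK,
      p 0 /\ (forall x y, p x -> p y -> p (x + y)),
      (forall a x, OK a -> p x -> p (a * x)),
      ~ p 1 /\ (exists2 x, p x & x != 0) &
      forall x y, OK x -> OK y -> p (x * y) -> p x \/ p y].

Definition prime_ideals := {p : set K | `[< prime_ideal p >]}.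

Definition ideal_mul I J : set K :=
  [set x | exists n (a b : 'I_n -> K),
     (forall i, I (a i) /\ J (b i)) /\ x = \sum_i a i * b i].

Definition ideal_inv I : set K := [set x | forall y, I y -> OK (x * y)].

Definition ideal_exp I (m : int) : set K :=
  match m with
  | Posz n => iter n (ideal_mul I) OK
  | Negz n => iter n.+1 (ideal_mul (ideal_inv I)) OK
  end.

Definition principal (alpha : K) : set K :=
  [set alpha * x | x in OK].

(* The exponents nu_q(a) of the prime factorisation of a fractional ideal,
   picked by the choice operator (they exist and are unique). *)
Definition valuations (a : set K) : {fsfun prime_ideals -> int with 0} :=
  xget [fsfun]
    [set v : {fsfun prime_ideals -> int with 0} |
      a = \big[ideal_mul/OK]_(q <- finsupp v) ideal_exp (val q) (v q)].

End FractionalIdeals.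

(* Symmetric functions in x_0, x_1, x_2, ... are the sequences of symmetric
   polynomials f_n(x_0, ..., x_(n-1)) of bounded degree that are compatible with
   x_n := 0 (the inverse limit of the graded rings Z[x_0, ..., x_(n-1)]^(S_n)).
   [mpoly n int] is used instead of its notation, which monalg overrides. *)
Definition truncate n (p : mpoly n.+1 int) : mpoly n int :=
  p \mPo [tuple if unlift ord_max i is Some j then 'X_j else 0 | i < n.+1].

Definition symmetric_function (f : forall n, mpoly n int) :=
  [/\ forall n, f n \is symmetric,
      forall n, truncate (f n.+1) = f n &
      exists d, forall n, (msize (f n) <= d)%N].

(* p_r : x |-> x^r for every variable x *)
Definition adams (V : choiceType) (r : nat)
    (F : nat -> {malg int[{cmonom V}]}) : nat -> {malg int[{cmonom V}]} :=
  fun n => monalg.mmap (intr : int -> {malg int[{cmonom V}]})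
             (fun m : {cmonom V} => << m >> ^+ r) (F n).

Section ConstantCoefficient.
Variable V : choiceType.
Local Notation seqs := (nat -> {malg int[{cmonom V}]}).

Definition constant_coef (F : seqs) : int := monalg.mcoeff mone (F 0%N).

Lemma constant_coefB : {morph constant_coef : F G / F - G}.
Proof. by move=> F G; apply: raddfB. Qed.

Lemma constant_coefM : {morph constant_coef : F G / F * G}.
Proof. by move=> F G; apply: (rmorphM (monalg.mcoeff mone)). Qed.

Lemma constant_coef1 : constant_coef 1 = 1.
Proof. exact: (rmorph1 (monalg.mcoeff mone)). Qed.

HB.instance Definition _ :=
  GRing.isZmodMorphism.Build seqs int constant_coef constant_coefB.
HB.instance Definition _ :=
  GRing.isMonoidMorphism.Build seqs int constant_coef
    (conj constant_coef1 constant_coefM).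

Lemma constant_coef_adams r F :
  (0 < r)%N -> constant_coef (adams r F) = constant_coef F.
Proof.
move=> r0; rewrite /constant_coef /adams; move: (F 0%N) => p {F}.
rewrite [in RHS](monalgE p) /monalg.mmap !raddf_sum /=.
apply: eq_bigr => m _; rewrite rmorphM rmorphXn /= rmorph_int intz.
have mU (c : int) : monalg.mcoeff mone << c *g m >> = c *+ (m == mone).
  exact: monalg.mcoeffU.
rewrite [X in _ * X ^+ r]mU [RHS]mU; case: (m == mone).
  by rewrite expr1n mulr1.
by rewrite mulr0n expr0n eqn0Ngt r0 mulr0.
Qed.

End ConstantCoefficient.

(* The pair (q, i) is the index of the variable x_i^(q). *)
Definition variables (K : fieldExtType rat) : choiceType :=
  (prime_ideals K * nat)%type.
Notation multi_poly K := {malg int[{cmonom (variables K)}]}.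

Section TensorProduct.
Variable K : fieldExtType rat.

Definition variable (q : prime_ideals K) (i : nat) : multi_poly K := << ucm (q, i) >>.

(* Sequences (F_n)_n, where F_n only uses the first n variables of each
   alphabet; the ring operations are pointwise. *)
Definition poly_seq := (nat -> multi_poly K)%type.

(* f |-> f(X^(q)) *)
Definition in_alphabet (q : prime_ideals K) (f : forall n, mpoly n int) : poly_seq :=
  fun n => mpoly.mmap (intr : int -> multi_poly K)
             (fun i : 'I_n => variable q i) (f n).

(* A_K(Z), as an internal tensor product: the rings Lambda[X^(q)] are free over
   Z and use disjoint sets of variables, so that the tensor product of any
   finite number of them is the subring that they generate, and the direct limit
   is the subring generated by all of them. *)
Definition AK_pred : {pred poly_seq} :=
  generated_subring
    [set F | exists q f, symmetric_function f /\ F = in_alphabet q f].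

Lemma AK_pred_subring : subring_closed AK_pred.
Proof. exact: generated_subring_closed. Qed.

HB.instance Definition _ :=
  GRing.isSubringClosed.Build poly_seq AK_pred AK_pred_subring.

Record AK := MkAK { AKval : poly_seq; AKvalP : AKval \in AK_pred }.

HB.instance Definition _ := [isSub for AKval].
HB.instance Definition _ := [Choice of AK by <:].
HB.instance Definition _ := [SubChoice_isSubComNzRing of AK by <:].
HB.instance Definition _ :=
  GRing.RMorphism.copy AKval (val : AK -> poly_seq).

(* For the partition of r with [m i] parts equal to [i.+1]. *)
Definition zee r (m : {ffun 'I_r -> 'I_r.+1}) : nat :=
  (\prod_(i < r) (i.+1 ^ m i * (m i)`!))%N.

(* h_r[F], from h_r = \sum_(lambda |- r) z_lambda^-1 p_lambda. It is the unique
   element G of the torsion-free ring A_K(Z) such that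
   r! G = \sum_lambda (r! / z_lambda) p_lambda[F]. *)
Definition plethysm_h (r : nat) (F : AK) : AK :=
  xget 0 [set G : AK | AKval G *+ r`! =
    \sum_(m : {ffun 'I_r -> 'I_r.+1} | (\sum_(i < r) i.+1 * m i == r)%N)
       (\prod_(i < r) adams i.+1 (AKval F) ^+ m i) *+ (r`! %/ zee m)].

End TensorProduct.

Section ClassRing.
Variable K : fieldExtType rat.

Definition variable_sum n : mpoly n int := \sum_(i < n) 'X_i.

Lemma variable_sum_symmetric : symmetric_function variable_sum.
Proof.
split.
- by move=> n; rewrite /variable_sum -mesym1E mesym_sym.
- move=> n; rewrite /truncate /variable_sum raddf_sum big_ord_recr /=.
  rewrite comp_mpolyXU -tnth_nth tnth_mktuple unlift_none addr0.
  apply: eq_bigr => i _.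
  rewrite comp_mpolyXU -(tnth_nth _ _ (widen_ord _ i)) tnth_mktuple.
  have -> : widen_ord (leqnSn n) i = lift ord_max i.
    by apply: val_inj; rewrite /= /bump leqNgt ltn_ord.
  by rewrite liftK.
- exists 2 => n; apply: (leq_trans (msize_sum _ _ _)).
  by apply/bigmax_leqP => i _; rewrite msizeX mdeg1.
Qed.

Lemma alphabet_sum_mem (q : prime_ideals K) :
  in_alphabet q variable_sum \in @AK_pred K.
Proof.
apply: mem_generated_subring; exists q, variable_sum; split => //.
exact: variable_sum_symmetric.
Qed.

(* X^(q) = x_0^(q) + x_1^(q) + ... *)
Definition alphabet_sum (q : prime_ideals K) : AK K :=
  MkAK (alphabet_sum_mem q).

(* H^(m)_a *)
Definition Hpoly (m : nat) (a : set K) : AK K :=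
  plethysm_h m
    (\sum_(q <- finsupp (valuations a)) alphabet_sum q *~ valuations a q).

Definition PK : {pred AK K} :=
  generated_ideal
    [set G | exists m alpha,
       [/\ (0 < m)%N, alpha != 0 & G = Hpoly m (principal alpha)]].

Lemma constant_coef_alphabet_sum q : constant_coef (AKval (alphabet_sum q)) = 0.
Proof.
rewrite /constant_coef /= /in_alphabet /variable_sum big_ord0.
by rewrite (raddf0 (mpoly.mmap _ _)) raddf0.
Qed.

Lemma constant_coef_Hpoly m a :
  (0 < m)%N -> constant_coef (AKval (Hpoly m a)) = 0.
Proof.
move=> m0; rewrite /Hpoly; set F := \sum_(q <- _) _.
have F0 : constant_coef (AKval F) = 0.
  rewrite /F !raddf_sum big1 // => q _.
  by rewrite !raddfMz /= constant_coef_alphabet_sum mul0rz.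
rewrite /plethysm_h; case: xgetP => [G _ /= Geq|_]; last by rewrite !raddf0.
have : constant_coef (AKval G *+ m`!) = 0.
  rewrite Geq raddf_sum big1 // => f /eqP fm.
  rewrite raddfMn /= rmorph_prod /=.
  have /existsP[i fi] : [exists i, f i != ord0].
    apply: contraLR m0 => /existsPn f0; rewrite -fm -leqNgt leqn0 big1 // => i _.
    by have := f0 i; rewrite negbK => /eqP ->; rewrite muln0.
  have fi0 : nat_of_ord (f i) == 0%N = false by exact: negPf fi.
  apply/eqP; rewrite mulrn_eq0; apply/orP; right; apply/prodf_eq0.
  exists i; rewrite // rmorphXn /= (constant_coef_adams _ (ltn0Sn i)).
  by rewrite F0 expr0n fi0.
rewrite raddfMn /= => /eqP; rewrite mulrn_eq0 eqn0Ngt fact_gt0 /=.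
by move/eqP.
Qed.

Lemma PK_idealr : idealr_closed PK.
Proof.
have [[P0 PB] PM] : ideal_closed PK by exact: generated_ideal_closed.
split => //; last first.
  move=> a u v uP vP; rewrite -[v]opprK -[- v]sub0r.
  exact: PB (PM _ _ uP) (PB _ _ P0 vP).
pose S : {pred AK K} := [pred F | constant_coef (AKval F) == 0].
apply/negP => /asboolP P1; have : 1 \in S.
  apply: P1; last first.
    by move=> _ [m [alpha [m0 _ ->]]]; rewrite inE constant_coef_Hpoly.
  split; first split.
  - by rewrite inE !raddf0.
  - by move=> F G; rewrite !inE !raddfB /= => /eqP -> /eqP ->; rewrite subr0.
  - by move=> F G; rewrite !inE !rmorphM /= => /eqP ->; rewrite mulr0.
by rewrite inE !rmorph1 oner_eq0.
Qed.

HB.instance Definition _ := isIdealr.Build (AK K) PK PK_idealr.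

Definition class_ring := {ideal_quot PK}.

HB.instance Definition _ := Choice.on class_ring.
HB.instance Definition _ := GRing.ComNzRing.on class_ring.

Definition class_pi (F : AK K) : class_ring := \pi_({ideal_quot PK})%qT F.

(* F mod P_K |-> h_r[F] mod P_K, computed on the chosen representative; it only
   deserves this description once P_K is known to be stable under h_r. *)
Definition class_h (r : nat) (x : class_ring) : class_ring :=
  class_pi (plethysm_h r (repr (x : {ideal_quot PK}))).

End ClassRing.

(* Main.v *)
(* By finiteness of the class number there is a finite set [S] of primes such
   that every prime [q] is equivalent, up to a principal ideal, to the inverse of
   a product of primes of [S] (Hurwitz: for every ideal [I] some [c] in [I]
   satisfies [M I <= c O_K], with [M] independent of [I]; thus [(c) = q J] with
   [M] in [J], and [S] is the set of primes containing [M]). Modulo [P_K] the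
   alphabet [X^(q)] then becomes minus the sum of the alphabets of the prime
   factors of [J], so that the alphabets [X^(p)] with [p] in [S] generate the
   class ring.

   That the operations [h_r] exist on [A_K] and preserve [P_K] is proved with
   Witt vectors. For a nonunital subring [J] of a torsion-free ring with Adams
   operations, the complete functions [h_r[x]] all lie in [J] iff
   [psi_n(x) = \sum_(k | n) k c_k^(n/k)] for some [c_k] in [J]. This condition is
   additive in [x], and multiplicative by an explicit formula. By Dwork's lemma it
   holds for all [x] in a subring [B] as soon as [psi_p] lifts the Frobenius of
   [B] for all primes [p], which can be checked on generators of [B]. Applied to
   [B = A_K] this gives the operations [h_r]. Applied to the subring generated by
   the [h_j[u]], it shows that [h_r[h_m[u]]] is an integral polynomial in the
   [h_j[u]], without constant term. *)

Require Import Defs.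
From mathcomp Require Import all_boot all_algebra all_field.
From HB Require Import structures.
From mathcomp Require Import all_order finmap perm.
From mathcomp Require Import boolp classical_sets functions.
From mathcomp Require Import monalg mpoly.
From mathcomp Require Import ring lra zify.

Set Implicit Arguments.
Unset Strict Implicit.
Unset Printing Implicit Defensive.

Import GRing.Theory Num.Theory Order.TTheory.

Local Open Scope ring_scope.

(** * Exponentials of ghost components *)

(** The operations have denominators and torsion-freeness is not known for the class ring, so
    integrality is always studied upstairs, in the torsion-free ring [poly_seq]; it descends to the
    quotient through the addition formula for [h_r]. The exponential of the ghost components is
    never formed: [newton] states X G' = a G, which makes sense without division and, truncated in
    degree [N], for polynomials. Torsion-freeness makes the solution unique; the question is whether
    one with coefficients in J exists. Dwork's lemma is applied to subrings B for which it is not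
    known beforehand that psi_p preserves them. The way out is that the elements of B at which psi_p
    lifts Frobenius form a subring, and that the Witt coordinates of the generators belong to it. On
    the arithmetic side [valuations] is a choice, so unique factorisation must be proved too. No
    integral basis is constructed: the finiteness of O_K/m, from linear dependence modulo primes,
    replaces Noetherian arguments, and Hurwitz's lemma makes every nonzero ideal invertible. *)

Section Series.
Variable R : comNzRingType.
Implicit Types (G H P Q : {poly R}) (a b : nat -> R) (J : R -> Prop).

Definition eqm N P Q := forall n, (n <= N)%N -> P`_n = Q`_n.

Lemma eqm_refl N P : eqm N P P. Proof. by []. Qed.
Lemma eqm_sym N P Q : eqm N P Q -> eqm N Q P.
Proof. by move=> h n /h ->. Qed.
Lemma eqm_trans N P Q G : eqm N P Q -> eqm N Q G -> eqm N P G.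
Proof. by move=> h h' n nN; rewrite h ?h'. Qed.
Lemma eqmD N P Q P' Q' : eqm N P Q -> eqm N P' Q' -> eqm N (P + P') (Q + Q').
Proof. by move=> h h' n nN; rewrite !coefD h ?h'. Qed.
Lemma eqmN N P Q : eqm N P Q -> eqm N (- P) (- Q).
Proof. by move=> h n nN; rewrite !coefN h. Qed.
Lemma eqmM N P Q P' Q' : eqm N P Q -> eqm N P' Q' -> eqm N (P * P') (Q * Q').
Proof.
move=> h h' n nN; rewrite !coefM; apply: eq_bigr => i _.
by rewrite h ?h' //; [apply: leq_trans (leq_subr _ _) nN
  | apply: leq_trans nN; rewrite -ltnS].
Qed.
Lemma eqm_leq M N P Q : (M <= N)%N -> eqm N P Q -> eqm M P Q.
Proof. by move=> MN h n nM; apply/h/(leq_trans nM). Qed.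

Lemma coef_Xderiv P n : ('X * P^`())`_n = P`_n *+ n.
Proof. by rewrite coefXM; case: n => [|n] //=; rewrite coef_deriv. Qed.

Lemma eqm_Xderiv N P Q : eqm N P Q -> eqm N ('X * P^`()) ('X * Q^`()).
Proof. by move=> h n nN; rewrite !coef_Xderiv h. Qed.

(* [a 0] is ignored: ghost components are indexed from 1. *)
Definition ghost_poly N a : {poly R} :=
  \poly_(i < N.+1) (if i is 0 then 0 else a i).

Lemma coef_ghost_poly N a n :
  (ghost_poly N a)`_n = if (0 < n <= N)%N then a n else 0.
Proof. by rewrite coef_poly ltnS; case: n => [|n] //=; case: ifP. Qed.

(* [G = exp (\sum_(k > 0) a k / k 'X^k)] modulo ['X^N.+1], up to a constant *)
Definition newton N a G := eqm N ('X * G^`()) (ghost_poly N a * G).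

Lemma eq_ghost_poly N a b :
  (forall n, (0 < n <= N)%N -> a n = b n) -> ghost_poly N a = ghost_poly N b.
Proof.
by move=> h; apply/polyP => n; rewrite !coef_ghost_poly; case: ifP => // /h.
Qed.

Lemma eq_newton N a b G :
  (forall n, (0 < n <= N)%N -> a n = b n) -> newton N a G -> newton N b G.
Proof. by move=> h; rewrite /newton (eq_ghost_poly h). Qed.

Lemma newton_eqm N a G H : eqm N G H -> newton N a G -> newton N a H.
Proof.
move=> GH nG; apply: eqm_trans (eqm_Xderiv (eqm_sym GH)) _.
by apply: eqm_trans nG _; apply: eqmM.
Qed.

Lemma newton_leq M N a G : (M <= N)%N -> newton N a G -> newton M a G.
Proof.
move=> MN nG; apply: eqm_trans (eqm_leq MN nG) _; apply: eqmM => // n nM.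
rewrite !coef_ghost_poly; case: n nM => //= n nM.
by rewrite nM (leq_trans nM MN).
Qed.

Lemma newton_coef N a G n : newton N a G -> (n <= N)%N ->
  G`_n *+ n = \sum_(k < n) a k.+1 * G`_(n - k.+1).
Proof.
move=> nG nN; have := nG n nN; rewrite coef_Xderiv coefM big_ord_recl /=.
rewrite coef_ghost_poly /= mul0r add0r => ->; apply: eq_bigr => i _.
by rewrite coef_ghost_poly /= (leq_trans (ltn_ord i) nN).
Qed.

(** [newton] describes the logarithmic derivative, so this is Leibniz's rule. *)
Lemma newtonM N a b G H : newton N a G -> newton N b H ->
  newton N (fun n => a n + b n) (G * H).
Proof.
move=> nG nH; rewrite /newton.
have -> : ghost_poly N (fun n => a n + b n)
    = ghost_poly N a + ghost_poly N b.
  apply/polyP => n; rewrite coefD !coef_ghost_poly.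
  by case: ifP; rewrite ?addr0.
have -> : 'X * (G * H)^`() = ('X * G^`()) * H + G * ('X * H^`()).
  by rewrite derivM; ring.
have -> : (ghost_poly N a + ghost_poly N b) * (G * H)
   = (ghost_poly N a * G) * H + G * (ghost_poly N b * H) by ring.
by apply: eqmD; apply: eqmM.
Qed.

Lemma newtonV N a G H : newton N a G -> eqm N (G * H) 1 ->
  newton N (fun n => - a n) H.
Proof.
move=> nG GH; rewrite /newton.
have -> : ghost_poly N (fun n => - a n) = - ghost_poly N a.
  apply/polyP => n; rewrite coefN !coef_ghost_poly.
  by case: ifP; rewrite ?oppr0.
have h : eqm N ('X * G^`() * H + G * ('X * H^`())) 0.
  have := eqm_Xderiv GH; rewrite -polyC1 derivC mulr0 derivM.
  by congr eqm; ring.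
have h1 : eqm N (G * ('X * H^`())) (- (ghost_poly N a * G * H)).
  move=> n nN; have := h n nN; rewrite coefD coef0 addrC => /eqP.
  rewrite addr_eq0 => /eqP ->; rewrite !coefN; congr (- _).
  exact: (eqmM nG (eqm_refl _)).
have h2 : eqm N (G * ('X * H^`())) (- ghost_poly N a).
  apply: eqm_trans h1 _; rewrite -mulrA; apply: eqmN.
  by rewrite -[X in eqm _ _ X]mulr1; apply: eqmM.
(* [G] can only be cancelled up to degree [N], by multiplying with its truncated inverse [H]. *)
have h3 : eqm N (H * (G * ('X * H^`()))) (H * - ghost_poly N a).
  exact: eqmM.
rewrite [X in eqm _ _ X]mulrC; apply: eqm_trans h3; rewrite mulrA.
rewrite -[X in eqm _ X]mul1r; apply: eqmM => //; apply: eqm_sym.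
by rewrite mulrC.
Qed.

(** No unit is asked for, so that ideals such as [PK] qualify. *)
Definition nonunital_subring J :=
  [/\ J 0, forall x y, J x -> J y -> J (x - y)
    & forall x y, J x -> J y -> J (x * y)].

Lemma nuN J x : nonunital_subring J -> J x -> J (- x).
Proof. by case=> J0 JB _ Jx; rewrite -sub0r; apply: JB. Qed.
Lemma nuD J x y : nonunital_subring J -> J x -> J y -> J (x + y).
Proof.
move=> cJ Jx Jy; rewrite -[y]opprK; case: (cJ) => _ JB _; apply: JB => //.
exact: nuN.
Qed.
Lemma nu_sum J I r (P : pred I) F : nonunital_subring J ->
  (forall i, P i -> J (F i)) -> J (\sum_(i <- r | P i) F i).
Proof.
move=> cJ h; apply: big_ind => //; first by case: cJ.
by move=> x y; apply: nuD.
Qed.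
Lemma nuMn J x n : nonunital_subring J -> J x -> J (x *+ n).
Proof.
move=> cJ Jx; elim: n => [|n IH]; first by rewrite mulr0n; case: cJ.
by rewrite mulrS; apply: nuD.
Qed.
Lemma nuX J x n : nonunital_subring J -> J x -> J (x ^+ n.+1).
Proof.
by move=> [_ _ JM] Jx; elim: n => [//|n IH]; rewrite exprS; apply: JM.
Qed.

Definition one_plus J G := G`_0 = 1 /\ forall n, J G`_n.+1.

Lemma one_plus1 J : nonunital_subring J -> one_plus J 1.
Proof. by case=> J0 _ _; split; rewrite ?coef1 // => n; rewrite coef1. Qed.

Lemma one_plusM J G H : nonunital_subring J ->
  one_plus J G -> one_plus J H -> one_plus J (G * H).
Proof.
move=> cJ [G0 JG] [H0 JH]; split; first by rewrite coef0M G0 H0 mulr1.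
move=> n; rewrite coefM; apply: nu_sum => // -[[|i] ilt] _ /=.
  by rewrite subn0 G0 mul1r.
rewrite subSS; case: (n - i)%N => [|k]; first by rewrite H0 mulr1.
by case: cJ => _ _ JM; apply: JM.
Qed.

(** The inverse is corrected one degree at a time by subtracting the error term. *)
Lemma one_plusV J G N : nonunital_subring J -> one_plus J G ->
  exists2 H, one_plus J H & eqm N (G * H) 1.
Proof.
move=> cJ JG; elim: N => [|N [H JH GH]].
  exists 1; first exact: one_plus1.
  by move=> n; rewrite leqn0 => /eqP ->; rewrite mulr1 coef1 (proj1 JG).
have [G0 _] := JG; have [H0 JH'] := JH; have [_ JB _] := cJ.
have [_ JGH] := one_plusM cJ JG JH.
exists (H - (G * H)`_N.+1 *: 'X^(N.+1)).
  split; first by rewrite coefB coefZ coefXn mulr0 subr0.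
  move=> n; rewrite coefB coefZ coefXn; apply: JB => //.
  case: eqP => _; first by rewrite mulr1.
  by rewrite mulr0; case: cJ.
move=> n; rewrite mulrBr -scalerAr coefB coefZ coefMXn.
rewrite leq_eqVlt => /orP[/eqP ->|].
  by rewrite ltnn subnn G0 mulr1 subrr coef1.
by move=> nN; rewrite nN mulr0 subr0 GH.
Qed.

(* Up to degree [N], the series [exp (\sum_(k > 0) a k / k 'X^k)] is 1 plus a
   series with coefficients in [J]. *)
Definition expressible N J a := exists2 G, one_plus J G & newton N a G.

Lemma eq_expressible N J a b :
  (forall n, (0 < n <= N)%N -> a n = b n) ->
  expressible N J a -> expressible N J b.
Proof. by move=> h [G JG nG]; exists G => //; apply: eq_newton nG. Qed.

Lemma expressible_leq M N J a :
  (M <= N)%N -> expressible N J a -> expressible M J a.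
Proof. by move=> MN [G JG nG]; exists G => //; apply: newton_leq nG. Qed.

Lemma expressible0 N J : nonunital_subring J -> expressible N J (fun=> 0).
Proof.
move=> cJ; exists 1; first exact: one_plus1.
move=> n _; rewrite -polyC1 derivC mulr0 mulr1 coef_ghost_poly coef0.
by case: ifP.
Qed.

Lemma expressibleD N J a b : nonunital_subring J ->
  expressible N J a -> expressible N J b ->
  expressible N J (fun n => a n + b n).
Proof.
move=> cJ [G JG nG] [H JH nH]; exists (G * H); first exact: one_plusM.
exact: newtonM.
Qed.

Lemma expressibleN N J a : nonunital_subring J ->
  expressible N J a -> expressible N J (fun n => - a n).
Proof.
move=> cJ [G JG nG]; have [H JH GH] := one_plusV N cJ JG.
by exists H => //; apply: newtonV GH.
Qed.

Lemma expressibleB N J a b : nonunital_subring J ->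
  expressible N J a -> expressible N J b ->
  expressible N J (fun n => a n - b n).
Proof. by move=> cJ Ja Jb; apply: expressibleD => //; apply: expressibleN. Qed.

Lemma expressible_sum N J I r (P : pred I) (F : I -> nat -> R) :
  nonunital_subring J -> (forall i, P i -> expressible N J (F i)) ->
  expressible N J (fun n => \sum_(i <- r | P i) F i n).
Proof.
move=> cJ h; elim: r => [|i r IH].
  by apply: eq_expressible (expressible0 N cJ) => n _; rewrite big_nil.
have [Pi|nPi] := boolP (P i).
  apply: eq_expressible (expressibleD cJ (h i Pi) IH) => n _.
  by rewrite big_cons Pi.
by apply: eq_expressible IH => n _; rewrite big_cons (negPf nPi).
Qed.

Lemma expressibleMn N J a m : nonunital_subring J -> expressible N J a ->
  expressible N J (fun n => a n *+ m).
Proof.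
move=> cJ Ja; apply: eq_expressible (expressible_sum (index_enum 'I_m)
  (P := xpredT) (F := fun=> a) cJ (fun _ _ => Ja)) => n _.
by rewrite sumr_const card_ord.
Qed.

(* The ghost components of the Witt vector V_k [c]; the series is
   [(1 - c 'X^k)^-1]. *)
Definition bracket k (c : R) n :=
  if (k %| n)%N then c ^+ (n %/ k) *+ k else 0.

(** The sign is chosen so that the series is a polynomial; [expressibleN] takes the inverse
    afterwards. *)
Lemma newton_bracketN N k c : (0 < k)%N ->
  newton N (fun n => - bracket k c n) (1 - c *: 'X^k).
Proof.
move=> k0 n nN; rewrite coef_Xderiv mulrBr mulr1 -scalerAr !coefB !coefZ.
rewrite !coefMXn coefXn coef1 !coef_ghost_poly nN.
case: (posnP n) => [-> | n0] /=; first by rewrite k0 mulr0 subr0 mulr0n.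
rewrite ?mulr0n sub0r mulr_natr.
case: ltngtP => [nk|kn|->]; last first.
- by rewrite subnn /= mulr0 subr0 /bracket dvdnn divnn k0 expr1 mulNrn mulr1n.
- rewrite subn_gt0 kn (leq_trans (leq_subr _ _) nN) /= mulr0n oppr0 mul0rn.
  rewrite /bracket dvdn_subl ?(ltnW kn) //.
  case: ifP => [dk|_]; last by rewrite oppr0 mulr0 subr0.
  have -> : (n %/ k)%N = ((n - k) %/ k).+1.
    by rewrite -{1}(subnK (ltnW kn)) divnDr // divnn k0 addn1.
  by rewrite exprS mulrN opprK mulrnAr addNr.
- rewrite mulr0 subr0 mulr0n oppr0 mul0rn /bracket.
  case: ifP => [/(dvdn_leq n0)|_]; last by rewrite oppr0.
  by rewrite leqNgt nk.
Qed.

Lemma one_plus_bracketN J k c : nonunital_subring J -> (0 < k)%N -> J c ->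
  one_plus J (1 - c *: 'X^k).
Proof.
move=> cJ k0 Jc; split.
  by rewrite coefB coef1 coefZ coefXn (ltn_eqF k0) mulr0 subr0.
move=> n; rewrite coefB coef1 coefZ coefXn sub0r; apply: nuN => //.
case: eqP => _; first by rewrite mulr1.
by rewrite mulr0; case: cJ.
Qed.

Lemma expressible_bracket N J k c : nonunital_subring J -> (0 < k)%N -> J c ->
  expressible N J (bracket k c).
Proof.
move=> cJ k0 Jc; have h : expressible N J (fun n => - bracket k c n).
  exists (1 - c *: 'X^k); first exact: one_plus_bracketN.
  exact: newton_bracketN.
by apply: eq_expressible (expressibleN cJ h) => n _; rewrite opprK.
Qed.

Hypothesis torsion_free : forall (x : R) n, x *+ n.+1 = 0 -> x = 0.

Lemma mulrnI_tf (x y : R) n : (0 < n)%N -> x *+ n = y *+ n -> x = y.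
Proof.
case: n => // n _ /eqP; rewrite -subr_eq0 -mulrnBl => /eqP/torsion_free/eqP.
by rewrite subr_eq0 => /eqP.
Qed.

(** The equation expresses n times the n-th coefficient by the lower ones, and n can be
    cancelled. *)
Lemma newton_uniq N a G H : newton N a G -> newton N a H ->
  G`_0 = H`_0 -> eqm N G H.
Proof.
move=> nG nH GH0; elim/ltn_ind => -[//|n] IH nN.
apply: (@mulrnI_tf _ _ n.+1) => //.
rewrite (newton_coef nG nN) (newton_coef nH nN); apply: eq_bigr => i _.
congr (_ * _); apply: IH; first by rewrite subSS ltnS leq_subr.
by apply: leq_trans (leq_subr _ _) nN.
Qed.

(** The n-th ghost component of the big Witt vector with coordinates [c k]: only the divisors k of n
    contribute. *)
Definition ghost (c : nat -> R) n := \sum_(1 <= k < n.+1) bracket k (c k) n.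

Lemma bracket_gt k c n : (0 < n < k)%N -> bracket k c n = 0.
Proof.
by case/andP=> n0 nk; rewrite /bracket gtnNdvd.
Qed.

Lemma ghost_widen N c n : (0 < n <= N)%N ->
  ghost c n = \sum_(1 <= k < N.+1) bracket k (c k) n.
Proof.
case/andP=> n0 nN; rewrite (big_cat_nat (n := n.+1)) //=.
rewrite [X in _ + X]big_nat [X in _ + X]big1 ?addr0 // => k /andP[nk _].
by rewrite bracket_gt // n0.
Qed.

Lemma expressible_ghost N J c : nonunital_subring J ->
  (forall k, (0 < k <= N)%N -> J (c k)) -> expressible N J (ghost c).
Proof.
move=> cJ Jc.
apply: (@eq_expressible _ _
    (fun n => \sum_(1 <= k < N.+1 | (0 < k <= N)%N) bracket k (c k) n)).
  by move=> n nN; rewrite (ghost_widen _ nN) [RHS]big_nat.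
apply: expressible_sum => // k /andP[k0 kN]; apply: expressible_bracket => //.
by apply: Jc; rewrite k0.
Qed.

(** When the lower ghost components vanish, the recursion of [newton_coef] reduces to a_n = n
    G_n. *)
Lemma expressible_leading N J a n : expressible N J a ->
  (0 < n <= N)%N -> (forall m, (0 < m < n)%N -> a m = 0) ->
  exists2 x, J x & a n = x *+ n.
Proof.
move=> [G [G0 JG] nG] /andP[n0 nN] a0.
case: n n0 nN a0 => // n _ nN a0; exists G`_n.+1 => //.
rewrite (newton_coef nG nN) big_ord_recr /= subnn G0 mulr1 big1 ?add0r //.
by move=> i _; rewrite a0 ?mul0r //= ltnS ltn_ord.
Qed.

(** With [expressible_ghost], the equivalence between integral series and Witt vectors. Subtracting
    the brackets already found leaves N vanishing ghost components, so the next one is divisible by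
    N+1 and yields the next coordinate. *)
Lemma expressibleP N J a : nonunital_subring J -> expressible N J a ->
  exists2 c, (forall k, J (c k)) & forall n, (0 < n <= N)%N -> a n = ghost c n.
Proof.
move=> cJ; elim: N => [|N IH] Ja.
  exists (fun=> 0); first by case: cJ.
  by move=> n; rewrite leqn0; case: n.
have [c Jc ac] := IH (expressible_leq (leqnSn N) Ja).
pose a' n := a n - \sum_(1 <= k < N.+1) bracket k (c k) n.
have Ja' : expressible N.+1 J a'.
  apply: expressibleB => //.
  apply: (@eq_expressible _ _
     (fun n => \sum_(1 <= k < N.+1 | (0 < k < N.+1)%N) bracket k (c k) n)).
    by move=> n _; rewrite -big_nat.
  by apply: expressible_sum => // k /andP[k0 _]; apply: expressible_bracket.
have [||x Jx a'x] := expressible_leading (n := N.+1) Ja'; first by rewrite leqnn.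
  by move=> m /andP[m0 mN]; rewrite /a' -ghost_widen ?m0 // ac ?subrr // m0.
exists (fun k => if k == N.+1 then x else c k); first by move=> k; case: ifP.
move=> n /andP[n0]; rewrite leq_eqVlt => /orP[/eqP ->|nN].
  rewrite /ghost big_nat_recr //= eqxx [X in X + _](_ : _ =
    \sum_(1 <= k < N.+1) bracket k (c k) N.+1).
    rewrite [bracket _ x _]/bracket dvdnn divnn /= expr1 -a'x /a'.
    by rewrite addrC subrK.
  by apply: eq_big_nat => k /andP[_ kN]; rewrite (ltn_eqF kN).
rewrite ac ?n0 //; apply: eq_big_nat => k /andP[_ kn].
by rewrite (ltn_eqF (leq_trans kn nN)).
Qed.

End Series.

(** * Dwork's lemma *)

Section Divisibility.
Variable R : comNzRingType.
Implicit Types (B J : R -> Prop).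

Definition is_subring B := B 1 /\ nonunital_subring B.

Definition ideal_in B J :=
  [/\ nonunital_subring J, forall x, J x -> B x
    & forall b x, B b -> J x -> J (b * x)].

Definition multiples B n (x : R) := exists2 b, B b & x = b *+ n.

Lemma subring_int B (k : int) : is_subring B -> B k%:~R.
Proof.
case=> B1 cB; case: k => k; first exact: (nuMn _ cB).
by rewrite NegzE mulrNz; apply: (nuN cB); apply: (nuMn _ cB).
Qed.

Lemma subring_exp B x n : is_subring B -> B x -> B (x ^+ n).
Proof.
by move=> [B1 cB] Bx; case: n => [|n]; rewrite ?expr0 //; apply: nuX.
Qed.

Lemma multiples_ideal B n : is_subring B -> ideal_in B (multiples B n).
Proof.
move=> [B1 cB]; have [B0 BB BM] := cB; split.
- split; first by exists 0; rewrite ?mul0rn.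
  + by move=> _ _ [a Ba ->] [b Bb ->]; exists (a - b); rewrite ?mulrnBl; auto.
  + move=> _ _ [a Ba ->] [b Bb ->]; exists (a * b *+ n).
      by apply: nuMn => //; apply: BM.
    by rewrite mulrnAl mulrnAr.
- by move=> _ [a Ba ->]; apply: nuMn.
- by move=> b _ Bb [a Ba ->]; exists (b * a); [apply: BM | rewrite mulrnAr].
Qed.

Lemma multiples_coprime B m n x : is_subring B -> coprime m n -> (0 < m)%N ->
  multiples B m x -> multiples B n x -> multiples B (m * n) x.
Proof.
move=> [B1 cB] cmn m0 [a Ba xa] [b Bb xb].
have [u v e _] := egcdnP n m0; move: cmn; rewrite /coprime => /eqP cmn.
rewrite cmn in e.
exists (b *+ u - a *+ v).
  by case: (cB) => _ BB _; apply: BB; apply: nuMn.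
rewrite mulrnBl -!mulrnA.
have -> : (u * (m * n) = n * (u * m))%N by lia.
have -> : (v * (m * n) = m * (v * n))%N by lia.
by rewrite !mulrnA -xa -xb -!mulrnA e -mulrnBr ?leq_addr // addKn.
Qed.

(** The p-part of n is split off and the two coprime divisibilities are joined by Bezout. *)
Lemma multiples_logn B n x : is_subring B -> (0 < n)%N -> B x ->
  (forall p, prime p -> (p %| n)%N -> multiples B (p ^ logn p n) x) ->
  multiples B n x.
Proof.
move=> cB; elim/ltn_ind: n => n IH n0 Bx h.
have [n1|n1] := leqP n 1.
  by have -> : n = 1%N by [lia]; exists x.
have pp := pdiv_prime n1; have dp := pdiv_dvd n.
set p := pdiv n in pp dp.
have e : (n`_p * n`_p^' = n)%N by rewrite partnC.
rewrite -e; apply: multiples_coprime => //.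
- exact: coprime_partC.
- by rewrite p_part; apply: h.
have e' : (n`_p > 1)%N by rewrite p_part_gt1 mem_primes pp n0.
apply: IH => //; first by rewrite -{2}e ltn_Pmull.
move=> q pq; have [-> dq|qp dq] := eqVneq q p.
  have := part_pnat (p^')%N n => /pnatP -/(_ (part_gt0 _ _) p pp dq).
  by rewrite !inE eqxx.
have -> : logn q n`_p^' = logn q n.
  rewrite -[in RHS]e lognM // p_part lognX (logn_prime q pp) (negPf qp).
  by rewrite muln0 add0n.
by apply: h => //; apply: dvdn_trans dq (dvdn_part _ _).
Qed.

Lemma freshman B p x y : prime p -> is_subring B -> B x -> B y ->
  multiples B p ((x - y) ^+ p - (x ^+ p - y ^+ p)).
Proof.
move=> pp cB Bx By; have [B1 cB'] := cB; have [_ BB BM] := cB'.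
have [cm _ _] := multiples_ideal p cB.
have p0 := prime_gt0 pp.
have h : multiples B p ((x - y) ^+ p - (x ^+ p + (- y) ^+ p)).
  rewrite exprDn -(prednK p0) big_ord_recl big_ord_recr /= (prednK p0).
  rewrite /bump /= !add1n (prednK p0) subnn subn0 bin0 binn !mulr1n expr0 mulr1.
  rewrite expr0 mul1r.
  set S := \sum_(i < _) _; have -> : x ^+ p + (S + (- y) ^+ p) - (x ^+ p + (- y) ^+ p) = S.
    by ring.
  apply: (nu_sum (J := multiples B p)) => // i _.
  rewrite add1n; have ip : (0 < i.+1 < p)%N.
    by have := ltn_ord i; lia.
  have /dvdnP[m ->] := prime_dvd_bin pp ip.
  rewrite mulrnA.
  exists (x ^+ (p - i.+1) * (- y) ^+ i.+1 *+ m) => //.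
  apply: nuMn => //; apply: BM; apply: subring_exp => //; exact: nuN.
have -> : (x - y) ^+ p - (x ^+ p - y ^+ p) =
  ((x - y) ^+ p - (x ^+ p + (- y) ^+ p)) + ((- y) ^+ p + y ^+ p) by ring.
(* The sign matters only for p = 2, where (-y)^2 + y^2 is twice a square. *)
apply: nuD => //; rewrite exprNn; case: (even_prime pp) => [-> | op].
  exists (y ^+ 2); first exact: subring_exp.
  by rewrite sqrrN expr1n mul1r mulr2n.
by rewrite -signr_odd op expr1 mulN1r addNr; case: cm.
Qed.

(** In x^p - y^p = (x - y) S the cofactor S is congruent to p y^(p-1), hence to 0, modulo p, which
    gains one power of p. *)
Lemma multiples_powp B p i x y : is_subring B -> B x -> B y ->
  multiples B p (x - y) -> multiples B (p ^ i) (x - y) ->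
  multiples B (p ^ i.+1) (x ^+ p - y ^+ p).
Proof.
move=> cB Bx By dp [b Bb e]; have [B1 cB'] := cB; have [_ BB BM] := cB'.
have [cm _ cmM] := multiples_ideal p cB.
have [a Ba ea] : multiples B p (\sum_(j < p) x ^+ (p.-1 - j) * y ^+ j).
  have -> : \sum_(j < p) x ^+ (p.-1 - j) * y ^+ j =
     \sum_(j < p) (x ^+ (p.-1 - j) - y ^+ (p.-1 - j)) * y ^+ j + y ^+ p.-1 *+ p.
    rewrite -[X in _ *+ X]card_ord -sumr_const -big_split /=.
    apply: eq_bigr => j _; rewrite mulrBl -[y ^+ _ * _]exprD subnK ?subrK //.
    by have := ltn_ord j; lia.
  apply: nuD => //; last by exists (y ^+ p.-1) => //; apply: subring_exp.
  apply: (nu_sum (J := multiples B p)) => // j _.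
  rewrite mulrC; apply: (cmM _ _); first exact: subring_exp.
  rewrite subrXX mulrC; apply: cmM => //.
  by apply: nu_sum => // k _; apply: BM; apply: subring_exp.
exists (b * a); first exact: BM.
by rewrite subrXX e ea mulrnAl mulrnAr -mulrnA expnSr mulnC.
Qed.

Lemma multiples_powX B p i x y : is_subring B -> B x -> B y ->
  multiples B p (x - y) ->
  multiples B (p ^ i.+1) (x ^+ (p ^ i) - y ^+ (p ^ i)).
Proof.
move=> cB Bx By dp; elim: i => [|i IH]; first by rewrite expn0 !expr1 expn1.
have Bxi := subring_exp (p ^ i) cB Bx; have Byi := subring_exp (p ^ i) cB By.
rewrite (expnSr _ i) !exprM; apply: multiples_powp => //.
rewrite subrXX mulrC; have [_ _] := multiples_ideal p cB; apply => //.
have [_ cB'] := cB; case: (cB') => _ _ BM.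
by apply: nu_sum => // j _; apply: BM; apply: subring_exp.
Qed.

End Divisibility.

(** * Witt vectors and Frobenius lifts in a ring with Adams operations *)

Section Lambda.
Variable R : comNzRingType.
Hypothesis torsion_free : forall (x : R) n, x *+ n.+1 = 0 -> x = 0.
Variable psi : nat -> {rmorphism R -> R}.
Hypothesis psi1 : forall x, psi 1%N x = x.
Hypothesis psiM : forall m n x, psi m (psi n x) = psi (m * n)%N x.
Implicit Types (B J : R -> Prop).

Let orbit x n := psi n x.

Lemma poly_subring B : is_subring B ->
  is_subring (fun P : {poly R} => forall i, B P`_i).
Proof.
move=> [B1 cB]; have [B0 BB BM] := cB; split.
  by move=> i; rewrite coef1; case: eqP.
split.
- by move=> i; rewrite coef0.
- by move=> P Q BP BQ i; rewrite coefB; apply: BB.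
- by move=> P Q BP BQ i; rewrite coefM; apply: nu_sum => // j _; apply: BM.
Qed.

Lemma one_plus_coef B G : is_subring B -> one_plus B G -> forall i, B G`_i.
Proof. by case=> B1 _ [G0 BG] [|i] //; rewrite G0. Qed.

(** The series is (1 - c X^k) / (1 - b X^k) = 1 + (b - c) X^k / (1 - b X^k). *)
Lemma expressible_bracketB N B J k b c : is_subring B -> ideal_in B J ->
  (0 < k)%N -> B b -> B c -> J (b - c) ->
  expressible N J (fun n => bracket k b n - bracket k c n).
Proof.
move=> cB [cJ JB JM] k0 Bb Bc Jbc; have [B1 cB'] := cB.
have [_ _ BM] := cB'.
have BG := one_plus_bracketN cB' k0 Bb.
have [H BH GH] := one_plusV N cB' BG.
have nH := newtonV (@newton_bracketN _ N _ b k0) GH.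
have nc := @newton_bracketN _ N _ c k0.
exists (1 + (b - c) *: ('X^k * H)).
  split; first by rewrite coefD coef1 coefZ coefXnM k0 mulr0 addr0.
  move=> n; rewrite coefD coef1 coefZ coefXnM add0r; case: ifP => _.
    by rewrite mulr0; case: cJ.
  by rewrite mulrC; apply: JM => //; apply: one_plus_coef BH _.
apply: eq_newton (newton_eqm _ (newtonM nH nc)).
  by move=> n _ /=; rewrite opprK.
have -> : H * (1 - c *: 'X^k) =
  (1 - b *: 'X^k) * H + (b - c) *: ('X^k * H).
  by rewrite -!mul_polyC polyCB; ring.
exact: eqmD.
Qed.

(** The series is (1 - c^p X^(pk)) / (1 - c X^k)^p, which is 1 modulo p because [freshman] applies
    to polynomials over B. *)
Lemma expressible_bracket_prime N B p k c : prime p -> is_subring B ->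
  (0 < k)%N -> B c ->
  expressible N (multiples B p)
    (fun n => bracket k c n *+ p - bracket (p * k) (c ^+ p) n).
Proof.
move=> pp cB k0 Bc; have [B1 cB'] := cB; have [B0 _ BM] := cB'.
have p0 := prime_gt0 pp; have pk0 : (0 < p * k)%N by rewrite muln_gt0 p0.
have BG : one_plus B ((1 - c *: 'X^k) ^+ p).
  elim: (p) => [|m IH]; first exact: one_plus1.
  by rewrite exprS; apply: one_plusM => //; apply: one_plus_bracketN.
have [H BH GH] := one_plusV N cB' BG.
have nG : newton N (fun n => - bracket k c n *+ p) ((1 - c *: 'X^k) ^+ p).
  elim: (p) => [|m IH].
    move=> n _; rewrite expr0 -polyC1 derivC mulr0 mulr1 coef_ghost_poly coef0.
    by case: ifP.
  rewrite exprS; apply: eq_newton (newtonM (@newton_bracketN _ N _ c k0) IH).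
  by move=> n _ /=; rewrite mulrS.
have nH := newtonV nG GH.
have nc := @newton_bracketN _ N _ (c ^+ p) pk0.
have [D BD eD] : multiples (fun P : {poly R} => forall i, B P`_i) p
    ((1 - c *: 'X^k) ^+ p - (1 - c ^+ p *: 'X^(p * k))).
  have := freshman pp (poly_subring cB) (x := 1) (y := c *: 'X^k).
  rewrite expr1n exprZn -exprM [(k * p)%N]mulnC; apply.
    by move=> i; rewrite coef1; case: eqP.
  by move=> i; rewrite coefZ coefXn; case: eqP; rewrite ?mulr1 ?mulr0.
exists (1 - (D * H) *+ p).
  split.
    rewrite coefB coef1 coefMn coef0M.
    (* The constant term must be exactly 1, not just 1 modulo p. *)
    have : D`_0 *+ p = 0.
      rewrite -coefMn -eD coefB (proj1 BG) coefB coef1 coefZ coefXn.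
      by rewrite (ltn_eqF pk0) mulr0 subr0 subrr.
    case: (p) p0 => // m _ /torsion_free ->.
    by rewrite mul0r mul0rn subr0.
  move=> n; rewrite coefB coef1 sub0r coefMn -mulNrn.
  exists (- (D * H)`_n.+1) => //; apply: nuN => //.
  have [_ [_ _ +]] := poly_subring cB; apply => //.
  exact: one_plus_coef.
apply: eq_newton (newton_eqm _ (newtonM nH nc)).
  by move=> n _ /=; rewrite mulNrn opprK.
have -> : H * (1 - c ^+ p *: 'X^(p * k)) = ((1 - c *: 'X^k) ^+ p * H)
   - ((1 - c *: 'X^k) ^+ p - (1 - c ^+ p *: 'X^(p * k))) * H by ring.
by rewrite eD mulrnAl; apply: eqmD.
Qed.

(** Induction on k: once the lower coordinates agree modulo J, their brackets can be removed and the
    difference of the k-th coordinates is read off the leading ghost component. *)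
Lemma ghost_congruence N B J b c : is_subring B -> ideal_in B J ->
  (forall k, (0 < k <= N)%N -> B (c k)) ->
  expressible N J (fun n => ghost b n - ghost c n) ->
  forall k, (0 < k <= N)%N -> J (b k - c k).
Proof.
move=> cB iJ Bc Jbc; have [cJ JB _] := iJ.
elim/ltn_ind => n IH /andP[n0 nN].
pose a' m := ghost b m - ghost c m -
  \sum_(1 <= k < n | (0 < k < n)%N) (bracket k (b k) m - bracket k (c k) m).
have Ja' : expressible N J a'.
  apply: expressibleB => //; apply: expressible_sum => // k /andP[k0 kn].
  have kN : (0 < k <= N)%N by rewrite k0 (leq_trans (ltnW kn)).
  apply: (expressible_bracketB _ cB iJ) => //; [|exact: Bc|exact: IH].
  rewrite -[b k](subrK (c k)); apply: nuD; [by case: cB| |exact: Bc].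
  exact/JB/IH.
have a'E m : a' m = ghost b m - ghost c m
   - (\sum_(1 <= k < n) bracket k (b k) m - \sum_(1 <= k < n) bracket k (c k) m).
  by rewrite /a' -big_nat sumrB.
have [||x Jx] := expressible_leading (n := n) Ja'.
- by rewrite n0.
- move=> m /andP[m0 mn]; rewrite a'E; case: n n0 mn {a' Ja' a'E IH nN} => // n.
  by move=> _ mn; rewrite -!ghost_widen ?m0 // subrr.
have bn d : bracket n d n = d *+ n by rewrite /bracket dvdnn divnn n0.
rewrite a'E /ghost !big_nat_recr //= => e.
suff -> : b n - c n = x by [].
apply: (mulrnI_tf torsion_free (n := n)) => //.
by rewrite -e mulrnBl -!bn; ring.
Qed.

(** A condition on single elements: it defines a subring of B even when [psi p] is not known to
    preserve B. *)
Definition frobenius_lift p B x := B x /\ multiples B p (psi p x - x ^+ p).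

Lemma frobenius_lift_subring p B : prime p -> is_subring B ->
  is_subring (frobenius_lift p B).
Proof.
move=> pp cB; have [B1 cB'] := cB; have [B0 BB BM] := cB'.
have [cJ JB JM] := multiples_ideal p cB; split.
  split=> //; rewrite rmorph1 expr1n subrr; by case: cJ.
split.
- by split=> //; rewrite rmorph0 expr0n (gtn_eqF (prime_gt0 pp)) subr0; case: cJ.
- move=> x y [Bx dx] [By dy]; split; first exact: BB.
  have -> : psi p (x - y) - (x - y) ^+ p = (psi p x - x ^+ p)
     - (psi p y - y ^+ p) - ((x - y) ^+ p - (x ^+ p - y ^+ p)).
    by rewrite rmorphB; ring.
  by case: (cJ) => _ JJ _; apply: (JJ _ _ (JJ _ _ dx dy)); apply: freshman.
- move=> x y [Bx dx] [By dy]; split; first exact: BM.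
  have -> : psi p (x * y) - (x * y) ^+ p = x ^+ p * (psi p y - y ^+ p)
     + y ^+ p * (psi p x - x ^+ p) + (psi p x - x ^+ p) * (psi p y - y ^+ p).
    by rewrite rmorphM exprMn; ring.
  apply: nuD => //; last by case: (cJ) => _ _; apply.
  by apply: nuD => //; apply: JM => //; apply: subring_exp.
Qed.

Lemma psi_bracket m k c n : psi m (bracket k c n) = bracket k (psi m c) n.
Proof. by rewrite /bracket; case: ifP; rewrite ?rmorph0 // rmorphMn rmorphXn. Qed.

Lemma psi_ghost m c n : psi m (ghost c n) = ghost (fun k => psi m (c k)) n.
Proof. by rewrite rmorph_sum; apply: eq_bigr => k _; rewrite psi_bracket. Qed.

(** The Witt vector with coordinates psi_p(c_k) has the ghost components w_(pn), being the Frobenius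
    of c. Modulo p the Witt Frobenius is c_k -> c_k^p, so psi_p(c_k) and c_k^p agree modulo p B: the
    coordinates of w are Frobenius-liftable. *)
Lemma expressible_frobenius p B w : prime p -> is_subring B ->
  (forall N, expressible N B (orbit w)) ->
  forall N, expressible N (frobenius_lift p B) (orbit w).
Proof.
move=> pp cB Bw N; have [B1 cB'] := cB; have p0 := prime_gt0 pp.
(* The coordinates are taken up to p N because the ghost components of index p n are compared. *)
have [c Bc wc] := expressibleP cB' (Bw (p * N)%N).
have iJ := multiples_ideal p cB; have [cJ _ _] := iJ.
have [_ cS] := frobenius_lift_subring pp cB.
have Jd : expressible N (multiples B p)
    (fun n => ghost (fun k => psi p (c k)) n - ghost (fun k => c k ^+ p) n).
  apply: (@eq_expressible _ _ _ (fun n => \sum_(1 <= k < (p * N).+1 | (0 < k < (p * N).+1)%N)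
     (bracket k (c k) (p * n) - bracket k (c k ^+ p) n))).
    move=> n /andP[n0 nN].
    have pn0 : (0 < p * n <= p * N)%N by rewrite muln_gt0 p0 n0 leq_pmul2l.
    have nN' : (0 < n <= p * N)%N by rewrite n0 (leq_trans nN) ?leq_pmull.
    rewrite -psi_ghost -wc // /orbit psiM -/(orbit w (p * n)) wc //.
    by rewrite (ghost_widen _ pn0) (ghost_widen _ nN') -sumrB -big_nat.
  apply: expressible_sum => // k /andP[k0 _].
  (* For k = p j the bracket at p n is p times the j-th bracket at n; for k prime to p it equals the
     bracket of c_k^p at n. *)
  have [/dvdnP[j kj]|pk] := boolP (p %| k)%N.
    rewrite mulnC in kj; have j0 : (0 < j)%N by move: k0; rewrite kj muln_gt0 p0.
    apply: eq_expressible (expressible_bracket_prime N pp cB j0 (Bc k)).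
    move=> n _; rewrite -kj; congr (_ - _); rewrite /bracket kj.
    rewrite dvdn_pmul2l // divnMl //; case: ifP; rewrite ?mul0rn //.
    by rewrite -mulrnA [(j * p)%N]mulnC.
  apply: eq_expressible (expressible0 N cJ) => n _.
  have kp : coprime k p by rewrite coprime_sym prime_coprime.
  rewrite /bracket Gauss_dvdr //; case: ifP => kn; last by rewrite subrr.
  by rewrite -muln_divA // exprM subrr.
have dc := ghost_congruence cB iJ _ Jd.
apply: (@eq_expressible _ _ _ (ghost c)).
  move=> n /andP[n0 nN]; rewrite wc // n0 (leq_trans nN) // leq_pmull //.
apply: expressible_ghost => // k kN; split=> //; apply: dc => // j _.
exact: subring_exp.
Qed.

(* Dwork's lemma: [n] divides [psi n z - \sum_(k | n, k < n) k c_k^(n/k)] in [B],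
   as its [p]-part does for each prime [p]. *)
Lemma expressible_orbit B z : is_subring B ->
  (forall p x, prime p -> B x -> multiples B p (psi p x - x ^+ p)) -> B z ->
  forall N, expressible N B (orbit z).
Proof.
move=> cB lift Bz N; have [B1 cB'] := cB; have [B0 BB BM] := cB'.
have Bpsi p x : prime p -> B x -> B (psi p x).
  move=> pp Bx; rewrite -[psi p x](subrK (x ^+ p)); apply: nuD => //.
    by have [b Bb ->] := lift p x pp Bx; apply: nuMn.
  exact: subring_exp.
suff [c Bc zc] : exists2 c, (forall k, B (c k)) &
    forall n, (0 < n <= N)%N -> orbit z n = ghost c n.
  by apply: (@eq_expressible _ _ _ (ghost c));
    [move=> n /zc -> | apply: expressible_ghost].
elim: N => [|N [c Bc zc]]; first by exists (fun=> 0) => // -[].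
set n := N.+1.
pose y := orbit z n - \sum_(1 <= k < n) bracket k (c k) n.
suff [x Bx yx] : multiples B n y.
  exists (fun k => if k == n then x else c k); first by move=> k; case: ifP.
  move=> m /andP[m0]; rewrite leq_eqVlt => /orP[/eqP ->|mN].
    rewrite /ghost big_nat_recr //= eqxx [X in X + _](_ : _ =
      \sum_(1 <= k < n) bracket k (c k) n).
      rewrite [bracket _ x _]/bracket dvdnn divnn /= expr1 -yx /y.
      by rewrite addrC subrK.
    by apply: eq_big_nat => k /andP[_ kN]; rewrite (ltn_eqF kN).
  rewrite zc ?m0 //; apply: eq_big_nat => k /andP[_ km].
  by rewrite (ltn_eqF (leq_trans km mN)).
(* The index n = 1 has no prime divisor and is settled by [psi1]. *)
have [N0|N0] := posnP N.
  exists z => //; rewrite /y /n N0 big_geq // subr0 mulr1n; exact: psi1.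
have key p : prime p -> (p %| n)%N -> multiples B (p ^ logn p n) y.
  move=> pp /dvdnP[m nm]; rewrite mulnC in nm.
  have p1 := prime_gt1 pp; have p0 := prime_gt0 pp.
  have m0 : (0 < m)%N by have : (0 < n)%N by []; rewrite nm muln_gt0 => /andP[].
  have mN : (0 < m <= N)%N.
    by rewrite m0 -ltnS -/n nm ltn_Pmull.
  have [cJ JB JM] := multiples_ideal (p ^ logn p n) cB.
  have -> : y = \sum_(1 <= k < n | (0 < k < n)%N)
     (bracket k (psi p (c k)) m - bracket k (c k) n).
    rewrite /y nm {1}/orbit -psiM -nm -/(orbit z m) zc // psi_ghost.
    by rewrite (ghost_widen _ mN) -sumrB -big_nat.
  apply: (nu_sum (J := multiples B (p ^ logn p n))) => // k /andP[k0 _].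
  (* If k divides n = p m but not m, then n / k is prime to p, so k carries the whole p-part of n
     and the term is divisible by itself. *)
  have [/dvdnP[j mj]|km] := boolP (k %| m)%N; last first.
    rewrite {1}/bracket (negPf km) sub0r; apply: nuN => //; rewrite /bracket.
    case: ifP => // [/dvdnP[j nj]|_]; last by case: cJ.
    have pj : coprime p j.
      rewrite prime_coprime //; apply: contra km => /dvdnP[i ji].
      apply/dvdnP; exists i; apply/eqP.
      by rewrite -(eqn_pmul2l p0) -nm nj ji mulnAC [(p * _)%N]mulnC.
    have /dvdnP[i ki] : (p ^ logn p n %| k)%N.
      rewrite -(Gauss_dvdr _ (n := j)) ?coprimeXl //; first by rewrite -nj pfactor_dvdnn.
    exists (c k ^+ (n %/ k) *+ i); last by rewrite -mulrnA -ki.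
    by apply: nuMn => //; apply: subring_exp.
  have nj : n = (p * j * k)%N by rewrite nm mj mulnA.
  rewrite /bracket nm dvdn_mull ?mj ?dvdn_mull // mulnA !mulnK // -nj.
  rewrite exprM -mulrnBl.
  have j0 : (0 < j)%N by move: m0; rewrite mj muln_gt0 => /andP[].
  have [i ij ji] : exists2 i, (j = p ^ (logn p j) * i)%N & (0 < i)%N.
    have /dvdnP[i ij] := pfactor_dvdnn p j; exists i; first by rewrite mulnC.
    by move: j0; rewrite ij muln_gt0 => /andP[].
  have /dvdnP[l kl] := pfactor_dvdnn p k.
  have -> : logn p n = ((logn p j).+1 + logn p k)%N.
    rewrite nj !lognM ?muln_gt0 ?p0 // logn_prime // eqxx; lia.
  (* With n = p j k, raising psi_p(c_k) = c_k^p mod p to the power j gains v_p(j) factors p, and the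
     coefficient k supplies the remaining v_p(k). *)
  have [b Bb eb] : multiples B (p ^ (logn p j).+1) (psi p (c k) ^+ j - (c k ^+ p) ^+ j).
    have h := multiples_powX (logn p j) cB (Bpsi _ _ pp (Bc k))
      (subring_exp p cB (Bc k)) (lift _ _ pp (Bc k)).
    rewrite ij !exprM [X in multiples _ _ X]subrXX mulrC.
    rewrite -ij; have [_ _] := multiples_ideal (p ^ (logn p j).+1) cB; apply => //.
    have Bpc := Bpsi _ _ pp (Bc k).
    by apply: nu_sum => // a _; apply: BM; do 3?apply: subring_exp => //.
  exists (b *+ l); first exact: nuMn.
  by rewrite eb -!mulrnA {1}kl expnD; congr (_ *+ _); lia.
have n1 : (1 < n)%N by [].
apply: multiples_logn => //.
(* That [y] lies in [B] also follows from a single prime divisor; nothing is known yet about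
   [psi n z] for composite n. *)
have [b Bb yb] := key _ (pdiv_prime n1) (pdiv_dvd n).
by rewrite yb; apply: nuMn.
Qed.

(** The product of two Verschiebungs of Witt vectors. It lives on the common multiples of k and l,
    and k l = lcm * gcd accounts for the multiplicity. *)
Lemma bracketM k l (c d : R) n : (0 < k)%N -> (0 < l)%N ->
  bracket k c n * bracket l d n =
  bracket (lcmn k l) (c ^+ (l %/ gcdn k l) * d ^+ (k %/ gcdn k l)) n *+ gcdn k l.
Proof.
move=> k0 l0; rewrite /bracket dvdn_lcm.
case: (boolP (k %| n)%N) => kn; last by rewrite mul0r mul0rn.
case: (boolP (l %| n)%N) => ln; last by rewrite mulr0 mul0rn.
have g0 : (0 < gcdn k l)%N by rewrite gcdn_gt0 k0.
have kl : (lcmn k l %| n)%N by rewrite dvdn_lcm kn.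
have L0 : (0 < lcmn k l)%N by rewrite lcmn_gt0 k0.
have [m nm] := dvdnP kl.
have gk : (k %/ gcdn k l * gcdn k l = k)%N by rewrite divnK ?dvdn_gcdl.
have gl : (l %/ gcdn k l * gcdn k l = l)%N by rewrite divnK ?dvdn_gcdr.
have Lk : (lcmn k l = k * (l %/ gcdn k l))%N.
  by rewrite /lcmn -muln_divA ?dvdn_gcdr.
have Ll : (lcmn k l = l * (k %/ gcdn k l))%N.
  by rewrite lcmnC /lcmn gcdnC -muln_divA ?dvdn_gcdl.
have -> : (n %/ lcmn k l = m)%N by rewrite nm mulnK.
have -> : (n %/ k = l %/ gcdn k l * m)%N.
  by rewrite nm Lk (_ : m * _ = (l %/ gcdn k l * m) * k)%N ?mulnK //; lia.
have -> : (n %/ l = k %/ gcdn k l * m)%N.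
  by rewrite nm Ll (_ : m * _ = (k %/ gcdn k l * m) * l)%N ?mulnK //; lia.
rewrite -mulrnA muln_lcm_gcd exprMn !exprM.
by rewrite mulrnAl mulrnAr -mulrnA mulnC.
Qed.

(** In each product of brackets the coordinate [d l] occurs with the positive exponent k / gcd(k,
    l), so the ideal J absorbs the product. *)
Lemma expressibleM N B J x u : is_subring B -> ideal_in B J ->
  expressible N B (orbit x) -> expressible N J (orbit u) ->
  expressible N J (orbit (x * u)).
Proof.
move=> cB [cJ JB JM] Bx Ju; have [B1 cB'] := cB.
have [c Bc xc] := expressibleP cB' Bx.
have [d Jd ud] := expressibleP cJ Ju.
apply: (@eq_expressible _ _ _ (fun n => \sum_(1 <= k < N.+1 | (0 < k < N.+1)%N)
   \sum_(1 <= l < N.+1 | (0 < l < N.+1)%N) (bracket (lcmn k l)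
    (c k ^+ (l %/ gcdn k l) * d l ^+ (k %/ gcdn k l)) n *+ gcdn k l))).
  move=> n nN; rewrite /orbit rmorphM -/(orbit x n) -/(orbit u n) xc // ud //.
  rewrite !(ghost_widen _ nN) mulr_suml.
  rewrite -big_nat; apply: eq_big_nat => k /andP[k0 _].
  rewrite -big_nat mulr_sumr; apply: eq_big_nat => l /andP[l0 _].
  by rewrite bracketM.
apply: expressible_sum => // k /andP[k0 _].
apply: expressible_sum => // l /andP[l0 _].
apply: expressibleMn => //; apply: expressible_bracket => //.
  by rewrite lcmn_gt0 k0.
apply: JM; first exact: subring_exp.
have : (0 < k %/ gcdn k l)%N.
  by rewrite divn_gt0 ?gcdn_gt0 ?k0 // dvdn_leq // dvdn_gcdl.
by case: (k %/ _)%N => // m _; apply: nuX.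
Qed.

(** The Frobenius-liftable elements of B form a subring over which the orbits of [W] are
    expressible. As B is the smallest such subring, psi_p lifts Frobenius on all of B and Dwork's
    lemma applies. *)
Lemma lambda_closed B (W : R -> Prop) : is_subring B ->
  (forall w, W w -> forall N, expressible N B (orbit w)) ->
  (forall T, is_subring T ->
     (forall w, W w -> forall N, expressible N T (orbit w)) ->
     forall x, B x -> T x) ->
  forall z, B z -> forall N, expressible N B (orbit z).
Proof.
move=> cB BW gen z Bz; apply: expressible_orbit => // p x pp Bx.
have [_] // : frobenius_lift p B x.
apply: gen => //; first exact: frobenius_lift_subring.
by move=> w Ww; apply: expressible_frobenius => // N; apply: BW.
Qed.

End Lambda.

(** * Complete functions *)

Section PowerSumExpansion.

(** Induction on m: (i (m+1))! is a multiple of (i m)! times its top factor i (m+1). *)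
Lemma dvdn_expn_fact i m : (0 < i)%N -> (i ^ m * m`! %| (i * m)`!)%N.
Proof.
move=> i0; elim: m => [|m IH]; first by rewrite expn0 mul1n dvd1n.
have -> : (i ^ m.+1 * m.+1`! = (i ^ m * m`!) * (i * m.+1))%N.
  by rewrite expnS factS; lia.
have -> : (i * m.+1 = (i * m + i.-1).+1)%N by lia.
rewrite factS mulnC; apply: dvdn_mul => //.
apply: dvdn_trans IH _; rewrite (fact_split (leq_addr i.-1 (i * m))).
exact: dvdn_mulr.
Qed.

Lemma dvdn_prod_fact (I : Type) (s : seq I) (F : I -> nat) :
  (\prod_(i <- s) (F i)`! %| (\sum_(i <- s) F i)`!)%N.
Proof.
elim: s => [|i s IH]; first by rewrite !big_nil.
rewrite !big_cons -(bin_fact (leq_addr (\sum_(j <- s) F j) (F i))) addKn.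
by apply/dvdn_mull/dvdn_mul.
Qed.

Variable R : comNzRingType.
Hypothesis torsion_free : forall (x : R) n, x *+ n.+1 = 0 -> x = 0.

(* The exponential series is the product over [i] of the [exp (a_i / i 'X^i)],
   truncated and multiplied by a common denominator [D]. *)
Lemma newton_expansion r (a : nat -> R) G : newton r a G -> G`_0 = 1 ->
  G`_r *+ r`! =
  \sum_(m : {ffun 'I_r -> 'I_r.+1} | (\sum_(i < r) i.+1 * m i == r)%N)
    (\prod_(i < r) a i.+1 ^+ m i) *+
      (r`! %/ \prod_(i < r) (i.+1 ^ m i * (m i)`!)).
Proof.
move=> nG G0.
pose z (i : 'I_r) (j : 'I_r.+1) := (i.+1 ^ j * j`!)%N.
have z0 i j : (0 < z i j)%N by rewrite muln_gt0 expn_gt0 fact_gt0.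
pose D := (\prod_(i < r) \prod_(j < r.+1) z i j)%N.
have D0 : (0 < D)%N by apply: prodn_gt0 => i; apply: prodn_gt0 => j.
pose E i j := (D %/ z i j)%N.
have zE i j : (E i j * z i j = D)%N.
  apply: divnK; rewrite /D (bigD1 i) //= (bigD1 j) //= -mulnA.
  exact: dvdn_mulr.
pose P (i : 'I_r) : {poly R} := \sum_(j < r.+1) (a i.+1 ^+ j *+ E i j) *: 'X^(i.+1 * j).
have P0 i : (P i)`_0 = D%:R.
  rewrite coef_sum big_ord_recl big1 ?addr0.
    rewrite coefZ coefXn muln0 eqxx expr0 mulr1; congr (_ *+ _).
    by rewrite -(zE i ord0) /z expn0 fact0 !muln1.
  by move=> j _; rewrite coefZ coefXn lift0 mulnS addSn mulr0.
have nP (i : 'I_r) : newton r (fun n => if n == i.+1 then a n else 0) (P i).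
  rewrite /newton.
  have -> : ghost_poly r (fun n => if n == i.+1 then a n else 0)
      = a i.+1 *: 'X^(i.+1).
    apply/polyP => n; rewrite coef_ghost_poly coefZ coefXn.
    case: eqP => [->|_]; last by rewrite mulr0 if_same.
    by rewrite ltn_ord mulr1.
  have -> : 'X * (P i)^`() =
     \sum_(j < r.+1) (a i.+1 ^+ j *+ (E i j * (i.+1 * j))) *: 'X^(i.+1 * j).
    apply/polyP => n; rewrite coef_Xderiv !coef_sum -sumrMnl.
    apply: eq_bigr => j _; rewrite !coefZ coefXn; case: eqP => [->|_].
      by rewrite !mulr1 -mulrnA.
    by rewrite !mulr0 mul0rn.
  rewrite big_ord_recl /= muln0 muln0 mulr0n scale0r add0r mulr_sumr.
  rewrite big_ord_recr /=; set S := BIG_F.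
  move=> n nr; rewrite coefD.
  (* The last term has degree (i+1)(r+1) > r and falls outside the truncation. *)
  rewrite [X in _ = _ + X](_ : _ = 0) ?addr0.
    rewrite !coef_sum; apply: eq_bigr => j _.
    rewrite -scalerAl -scalerAr -exprD !coefZ !coefXn -mulnS.
    rewrite /bump /= add1n mulrA; congr (_ * _).
    rewrite mulrnAr -exprS; congr (_ *+ _).
    apply/eqP; rewrite -(eqn_pmul2r (z0 i (widen_ord (leqnSn r) j))) zE.
    rewrite -(zE i (lift ord0 j)) /z lift0 /= expnS factS; apply/eqP.
    set e := E _ _; lia.
  rewrite -scalerAl -scalerAr -exprD !coefZ coefXn.
  by rewrite -mulnS (ltn_eqF (leq_ltn_trans nr _)) ?mulr0 // mulSn ltn_addr.
have nPP : newton r a (\prod_(i < r) P i).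
  have h (s : seq 'I_r) : newton r
      (fun n => \sum_(i <- s) (if n == i.+1 then a n else 0)) (\prod_(i <- s) P i).
    elim: s => [|i s IH].
      move=> n _; rewrite big_nil -polyC1 derivC mulr0 mulr1 coef_ghost_poly.
      by rewrite big_nil coef0 if_same.
    rewrite big_cons; apply: eq_newton (newtonM (nP i) IH) => n _.
    by rewrite big_cons.
  apply: eq_newton (h _) => -[//|n] /= nr; rewrite (bigD1 (Ordinal nr)) //= eqxx.
  rewrite big1 ?addr0 // => i iN; rewrite eqSS; case: eqP => // ni.
  by case/eqP: iN; apply: val_inj.
have nGD : newton r a (D%:R ^+ r *: G).
  move=> n nr; rewrite derivZ -!scalerAr !coefZ; congr (_ * _); exact: nG.
have PP0 : (\prod_(i < r) P i)`_0 = (D%:R ^+ r *: G)`_0.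
  rewrite coefZ G0 mulr1 -horner_coef0 horner_prod.
  rewrite -[X in _ = _ ^+ X]card_ord -prodr_const; apply: eq_bigr => i _.
  by rewrite horner_coef0 P0.
have := newton_uniq torsion_free nPP nGD PP0 (leqnn r).
rewrite coefZ bigA_distr_bigA /= coef_sum => PG.
apply: (mulrnI_tf torsion_free (n := D ^ r)); first by rewrite expn_gt0 D0.
rewrite mulrnAC -[X in X *+ r`!]mulr_natl natrX -PG -!sumrMnl [RHS]big_mkcond.
apply: eq_bigr => f _.
have -> : \prod_(i < r) ((a i.+1 ^+ f i *+ E i (f i)) *: 'X^(i.+1 * f i)) =
   ((\prod_(i < r) a i.+1 ^+ f i) *+ (\prod_(i < r) E i (f i))) *:
   'X^(\sum_(i < r) i.+1 * f i).
  rewrite scaler_prod; congr (_ *: _); first by rewrite prodrMn.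
  by rewrite prodrXr.
rewrite coefZ coefXn eq_sym; case: eqP => [rf|_]; last by rewrite mulr0 mul0rn.
rewrite mulr1 -!mulrnA; congr (_ *+ _).
set zf := (\prod_(i < r) (_ * _))%N.
have zr : (zf %| r`!)%N.
  rewrite -[X in (_ %| X`!)%N]rf; apply: dvdn_trans (dvdn_prod_fact _ _).
  apply: (big_ind2 (fun x y => (x %| y)%N)) => // [x1 x2 y1 y2|i _]; first exact: dvdn_mul.
  exact: dvdn_expn_fact.
have zED : ((\prod_(i < r) E i (f i)) * zf = D ^ r)%N.
  rewrite -big_split /= -[X in (_ ^ X)%N]card_ord -prod_nat_const.
  by apply: eq_bigr => i _; rewrite zE.
by rewrite -zED -{1}(divnK zr); lia.
Qed.

End PowerSumExpansion.

(* [A] is a subring, closed under the operations [h r], of a torsion-free ring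
   [R] that carries the Adams operations. *)
Section LambdaRing.
Variables (R A : comNzRingType) (emb : {rmorphism A -> R}).
Hypothesis emb_inj : injective emb.
Hypothesis torsion_free : forall (x : R) n, x *+ n.+1 = 0 -> x = 0.
Variable psi : nat -> {rmorphism R -> R}.
Hypothesis psi1 : forall x, psi 1%N x = x.
Hypothesis psiM : forall m n x, psi m (psi n x) = psi (m * n)%N x.
Variable h : nat -> A -> A.
Hypothesis h_newton : forall r F (G : {poly R}),
  newton r (fun k => psi k (emb F)) G -> G`_0 = 1 -> emb (h r F) = G`_r.
Definition image_of (P : A -> Prop) (x : R) := exists2 F, P F & emb F = x.
Hypothesis A_expressible : forall F N,
  expressible N (image_of xpredT) (fun k => psi k (emb F)).

Definition h_series F N : {poly R} := \poly_(i < N.+1) emb (h i F).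

Lemma coef_h_series F N n : (n <= N)%N -> (h_series F N)`_n = emb (h n F).
Proof. by move=> nN; rewrite coef_poly ltnS nN. Qed.

Lemma h_series0 F N : (h_series F N)`_0 = 1.
Proof.
rewrite coef_h_series // (h_newton (G := 1)) ?coef1 // => n _.
rewrite -polyC1 derivC mulr0 mulr1 coef_ghost_poly coef0 leqn0.
by case: n.
Qed.

(** [A_expressible] provides some solution, and [h_newton] identifies its coefficients with the
    h_i[F]. *)
Lemma newton_h_series F N : newton N (fun k => psi k (emb F)) (h_series F N).
Proof.
have [G AG nG] := A_expressible F N; apply: (newton_eqm _ nG) => n nN.
rewrite coef_h_series //; apply/esym/h_newton; last by case: AG.
exact: newton_leq nG.
Qed.

Lemma expressible_h (T : R -> Prop) F : nonunital_subring T ->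
  (forall r, (0 < r)%N -> T (emb (h r F))) ->
  forall N, expressible N T (fun k => psi k (emb F)).
Proof.
move=> [T0 _ _] TF N; exists (h_series F N); last exact: newton_h_series.
split; first exact: h_series0.
by move=> n; rewrite coef_poly; case: ifP => // _; apply: TF.
Qed.

Lemma h_expressible (T : R -> Prop) F r : (0 < r)%N ->
  expressible r T (fun k => psi k (emb F)) -> T (emb (h r F)).
Proof. by case: r => // r _ [G [G0 TG] nG]; rewrite (h_newton nG G0). Qed.

(* In other words [h_r[h_m[F]]] is an integral polynomial in the [h_j[F]]. *)
Lemma h_comp (T : R -> Prop) F r m : is_subring T ->
  (forall j, (0 < j)%N -> T (emb (h j F))) ->
  (0 < m)%N -> (0 < r)%N -> T (emb (h r (h m F))).
Proof.
move=> cT TF m0 r0.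
(* The subring generated by the h_j[F], written as an intersection so that the minimality required
   by [lambda_closed] is immediate. *)
pose B (x : R) := forall T, is_subring T ->
  (forall N, expressible N T (fun k => psi k (emb F))) -> T x.
have cB : is_subring B.
  split; first by move=> T' [].
  split; first by move=> T' [_ []].
  + by move=> x y Bx By T' cT' TF'; case: (cT') => _ [_ TB _]; apply: TB;
      [apply: Bx | apply: By].
  + by move=> x y Bx By T' cT' TF'; case: (cT') => _ [_ _ TM]; apply: TM;
      [apply: Bx | apply: By].
have hB j : (0 < j)%N -> B (emb (h j F)).
  by move=> j0 T' cT' TF'; apply: h_expressible.
have FB : forall N, expressible N B (fun k => psi k (emb F)).
  by apply: expressible_h => //; case: cB.
have Bm : B (emb (h r (h m F))).
  apply: h_expressible => //.
  apply: (lambda_closed torsion_free psi1 psiM cB (W := fun w => w = emb F)).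
  + by move=> w ->.
  + by move=> T' cT' TF' x; apply=> // N; apply: TF'.
  + exact: hB.
by apply: Bm => //; apply: expressible_h => //; case: cT.
Qed.

Lemma hD r F G : emb (h r (F + G)) =
  \sum_(i < r.+1) emb (h i F) * emb (h (r - i) G).
Proof.
have n1 : newton r (fun k => psi k (emb (F + G))) (h_series F r * h_series G r).
  apply: eq_newton (newtonM (@newton_h_series F r) (@newton_h_series G r)) => k _.
  by rewrite -!rmorphD.
rewrite (h_newton n1) ?coef0M ?h_series0 ?mulr1 // coefM.
by apply: eq_bigr => i _; rewrite !coef_h_series ?leq_subr // -ltnS.
Qed.

Variable eps : {rmorphism R -> int}.
Hypothesis eps_psi : forall n x, (0 < n)%N -> eps (psi n x) = eps x.

Lemma eps_h r F : (0 < r)%N -> eps (emb F) = 0 -> eps (emb (h r F)) = 0.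
Proof.
move=> r0 F0; have := newton_coef (@newton_h_series F r) (leqnn r).
rewrite coef_h_series // => /(congr1 eps).
rewrite raddfMn raddf_sum /= big1 => [/eqP|i _].
  by rewrite mulrn_eq0 (gtn_eqF r0) => /eqP.
by rewrite rmorphM /= eps_psi // F0 mul0r.
Qed.

Variable U : A -> Prop.
Hypothesis eps_U : forall u, U u -> eps (emb u) = 0.
Variable P : {pred A}.
Hypothesis P_generated :
  P = generated_ideal [set G | exists m u, [/\ (0 < m)%N, U u & G = h m u]]%classic.

Let inP := image_of (fun F => F \in P).

Lemma P_ideal : ideal_closed P.
Proof. by rewrite P_generated; apply: generated_ideal_closed. Qed.

Lemma inA_subring : is_subring (image_of xpredT).
Proof.
split; first by exists 1; rewrite ?rmorph1.
split; first by exists 0; rewrite ?rmorph0.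
+ by move=> _ _ [F _ <-] [G _ <-]; exists (F - G); rewrite ?rmorphB.
+ by move=> _ _ [F _ <-] [G _ <-]; exists (F * G); rewrite ?rmorphM.
Qed.

Lemma inP_ideal : ideal_in (image_of xpredT) inP.
Proof.
have [[P0 PB] PM] := P_ideal; split.
- split; first by exists 0; rewrite ?rmorph0.
  + by move=> _ _ [F PF <-] [G PG <-]; exists (F - G); rewrite ?rmorphB ?PB.
  + by move=> _ _ [F PF <-] [G PG <-]; exists (F * G); rewrite ?rmorphM ?PM.
- by move=> _ [F _ <-]; exists F.
- by move=> _ _ [G _ <-] [F PF <-]; exists (G * F); rewrite ?rmorphM ?PM.
Qed.

Lemma inP_emb F : inP (emb F) -> F \in P.
Proof. by move=> [G PG /emb_inj <-]. Qed.

Lemma P_h m u : (0 < m)%N -> U u -> h m u \in P.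
Proof.
move=> m0 Uu; rewrite P_generated; apply/asboolP => S _; apply.
by exists m, u.
Qed.

Lemma generated_ideal_sub (X : set A) (S : {pred A}) : ideal_closed S ->
  (forall g, X g -> g \in S) -> {subset generated_ideal X <= S}.
Proof. by move=> cS XS x /asboolP; apply. Qed.

Lemma eps_P F : F \in P -> eps (emb F) = 0.
Proof.
rewrite P_generated => PF; apply/eqP; move: F PF.
apply: (generated_ideal_sub (S := [pred F | eps (emb F) == 0])).
  split; first split.
  - by rewrite inE !raddf0.
  - by move=> a b; rewrite !inE !raddfB /= => /eqP -> /eqP ->; rewrite subr0.
  - by move=> a b; rewrite !inE !rmorphM /= => /eqP ->; rewrite mulr0.
by move=> _ [m [u [m0 Uu ->]]]; rewrite inE eps_h // eps_U.
Qed.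

(** The elements whose positive complete functions all lie in P form an ideal, by additivity and
    [expressibleM]. It remains to treat the generators h_m[u], by [h_comp]. *)
Lemma P_lambda F r : F \in P -> (0 < r)%N -> h r F \in P.
Proof.
have [cP PA PM] := inP_ideal; have [P0 PB _] := cP; have cA := inA_subring.
pose S : {pred A} := fun F =>
  `[< forall N, expressible N inP (fun k => psi k (emb F)) >].
suff PS : {subset P <= S}.
  by move=> /PS /asboolP hF r0; apply: inP_emb; exact: (h_expressible (T := inP)).
rewrite P_generated; apply: generated_ideal_sub.
  split; first split.
  - apply/asboolP => N; apply: eq_expressible (expressible0 N cP) => k _.
    by rewrite !rmorph0.
  - move=> x y /asboolP hx /asboolP hy; apply/asboolP => N.
    apply: eq_expressible (expressibleB cP (hx N) (hy N)) => k _.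
    by rewrite -!rmorphB.
  - move=> a x /asboolP hx; apply/asboolP => N.
    by rewrite rmorphM; apply: (expressibleM cA inP_ideal).
move=> _ [m [u [m0 Uu ->]]]; apply/asboolP; apply: expressible_h => // {}r r0.
have PH j : (0 < j)%N -> inP (emb (h j u)).
  by move=> j0; exists (h j u) => //; apply: P_h.
(* [h_comp] requires a unital subring; Z + P is one. The augmentation [eps] then shows that the
   integer part of h_r[h_m[u]] is 0. *)
pose T (x : R) := exists (k : int) y, inP y /\ x = k%:~R + y.
have cT : is_subring T.
  split; first by exists 1, 0; rewrite addr0.
  split.
  - by exists 0, 0; rewrite addr0.
  - move=> _ _ [k [y [Py ->]]] [l [z [Pz ->]]]; exists (k - l), (y - z).
    by split; [apply: PB | rewrite rmorphB /=; ring].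
  - move=> _ _ [k [y [Py ->]]] [l [z [Pz ->]]].
    exists (k * l), (k%:~R * z + (l%:~R + z) * y); split.
      apply: nuD => //; apply: PM => //; first exact: subring_int.
      by apply: nuD; [case: cA | apply: subring_int | apply: PA].
    by rewrite rmorphM /=; ring.
have [k [y [Py e]]] : T (emb (h r (h m u))).
  apply: h_comp => // j j0; exists 0, (emb (h j u)).
  by rewrite add0r; split=> //; apply: PH.
rewrite e; suff -> : k = 0 by rewrite add0r.
have := congr1 eps e; rewrite eps_h ?eps_h ?eps_U // raddfD /= rmorph_int.
by have [G PG <-] := Py; rewrite eps_P // addr0 intz.
Qed.

(** In the expansion of h_r[G + y] with y in P, every term but h_r[G] has a factor h_j[y] with j >
    0. *)
Lemma h_congr r F G : F - G \in P -> h r F - h r G \in P.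
Proof.
rewrite -[in h r F](subrK G F); move: (F - G) => y Py.
have [cP PA PM] := inP_ideal.
apply: inP_emb; rewrite [y + G]addrC rmorphB /= hD big_ord_recr /= subnn.
have -> : emb (h 0 y) = 1 by rewrite -(coef_h_series y (leqnn 0)) h_series0.
rewrite mulr1 addrK; apply: (nu_sum (J := inP)) => // i _; apply: PM; first by exists (h i G).
by exists (h (r - i) y) => //; apply: P_lambda; rewrite ?subn_gt0.
Qed.

Variables (C : comNzRingType) (pi : {rmorphism A -> C}) (hC : nat -> C -> C).
Hypothesis pi_surj : forall x, exists F, x = pi F.
Hypothesis pi_P : forall F, F \in P -> pi F = 0.
Hypothesis hC_pi : forall r F, hC r (pi F) = pi (h r F).
Variables (I : eqType) (X : I -> A).
Hypothesis A_generated : forall T, is_subring T ->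
  (forall i N, expressible N T (fun k => psi k (emb (X i)))) ->
  forall F, T (emb F).

(** With u = X_i + \sum_(j <- l) X_j in U, the h_r[u] vanish in the quotient. Thus X_i = u - \sum_(j
    <- l) X_j is expressible over the preimage T of S, which is therefore everything. *)
Lemma quotient_generated (s : seq I) :
  (forall i, exists2 l, {subset l <= s} & U (X i + \sum_(j <- l) X j)) ->
  finitely_generated_lambda hC.
Proof.
move=> hs; exists [seq pi (X i) | i <- s] => S cS Sh Ss.
pose T := image_of (fun F => pi F \in S).
have [S1 SB SM] := cS; have S0 : 0 \in S by rewrite -(subrr 1) SB.
have cT' : nonunital_subring T.
  split; first by exists 0; rewrite ?rmorph0.
  + by move=> _ _ [F SF <-] [G SG <-]; exists (F - G); rewrite ?rmorphB ?SB.
  + by move=> _ _ [F SF <-] [G SG <-]; exists (F * G); rewrite ?rmorphM ?SM.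
have cT : is_subring T by split=> //; exists 1; rewrite ?rmorph1.
have TF F : pi F \in S -> forall N, expressible N T (fun k => psi k (emb F)).
  move=> SF; apply: expressible_h => // r _; exists (h r F) => //.
  by rewrite -hC_pi Sh.
move=> x; have [F ->] := pi_surj x.
suff [F' SF' /emb_inj <-] : T (emb F) by [].
apply: A_generated => // i N; have [l ls Ul] := hs i.
have Tu : expressible N T (fun k => psi k (emb (X i + \sum_(j <- l) X j))).
  apply: expressible_h => // r r0; exists (h r (X i + \sum_(j <- l) X j)) => //.
  by rewrite pi_P // P_h.
have Tl : expressible N T (fun k => psi k (emb (\sum_(j <- l) X j))).
  apply: TF; rewrite raddf_sum /= big_seq; apply: (big_ind (fun x => x \in S)) => //.
  + by move=> y z Sy Sz; rewrite -[z]opprK SB // -sub0r SB.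
  + by move=> j jl; apply/Ss/map_f/ls.
apply: eq_expressible (expressibleB cT' Tu Tl) => k _.
by rewrite -!rmorphB addrK.
Qed.

End LambdaRing.

(** * The ring A_K *)

Section SymmetricFunctions.

Lemma mpoly_morph_ext_supp k (S : comNzRingType)
    (f g : {rmorphism mpoly k int -> S}) p :
  (forall m, m \in msupp p -> f 'X_[m] = g 'X_[m]) -> f p = g p.
Proof.
move=> fg; rewrite [p]mpolyE !raddf_sum /= !big_seq; apply: eq_bigr => m mp.
rewrite -mul_mpolyC !rmorphM /= fg //; congr (_ * _).
by rewrite -[p@_m]intz !rmorph_int.
Qed.

Lemma mpoly_morph_ext k (S : comNzRingType) (f g : {rmorphism mpoly k int -> S}) :
  (forall i, f 'X_i = g 'X_i) -> f =1 g.
Proof.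
move=> fg p; apply: mpoly_morph_ext_supp => m _.
rewrite mpolyXE_id !rmorph_prod /=; apply: eq_bigr => i _.
by rewrite !rmorphXn /= fg.
Qed.

Definition eval_mesym k n (t : mpoly k int) : mpoly n int :=
  t \mPo [tuple mesym n int i.+1 | i < k].

Lemma truncate_mesym n k : truncate (mesym n.+1 int k) = mesym n int k.
Proof.
have tw (p : mpoly n int) : truncate (mwiden p) = p.
  pose f : {rmorphism mpoly n int -> mpoly n int} :=
    (comp_mpoly [tuple if unlift ord_max i is Some j then 'X_j else 0 | i < n.+1])
      \o @mwiden n int.
  apply: (mpoly_morph_ext (f := f) (g := idfun)) => i /=.
  rewrite mwidenX mnmwiden1 comp_mpolyXU -tnth_nth tnth_mktuple.
  have -> : widen_ord (leqnSn n) i = lift ord_max i.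
    by apply: val_inj; rewrite /= /bump leqNgt ltn_ord.
  by rewrite liftK.
case: k => [|k]; first by rewrite !mesym0E /truncate rmorph1.
rewrite mesymSS /truncate rmorphD rmorphM /= -!/(truncate _) !tw.
by rewrite /truncate comp_mpolyXU -tnth_nth tnth_mktuple unlift_none mulr0 addr0.
Qed.

Lemma mesym_symmetric_function k :
  symmetric_function (fun n => mesym n int k).
Proof.
split; [by move=> n; apply: mesym_sym | by move=> n; apply: truncate_mesym |].
exists k.+1 => n; rewrite mesymE; apply: leq_trans (msize_sum _ _ _) _.
by apply/bigmax_leqP => h /eqP hk; rewrite msizeX mdeg_mesym1 hk.
Qed.

Lemma truncate_eval_mesym k n t :
  truncate (@eval_mesym k n.+1 t) = eval_mesym n t.
Proof.
pose f : {rmorphism mpoly k int -> mpoly n int} :=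
  (comp_mpoly [tuple if unlift ord_max i is Some j then 'X_j else 0 | i < n.+1])
    \o (comp_mpoly [tuple mesym n.+1 int i.+1 | i < k]).
apply: (mpoly_morph_ext (f := f)
  (g := comp_mpoly [tuple mesym n int i.+1 | i < k])) => i /=.
by rewrite !comp_mpolyXU -!tnth_nth !tnth_mktuple -/(truncate _) truncate_mesym.
Qed.

(** The elementary function of degree n+1 vanishes in n variables. *)
Lemma eval_mesym_truncate n (t : mpoly n.+1 int) :
  eval_mesym n t = eval_mesym n (truncate t).
Proof.
pose f : {rmorphism mpoly n.+1 int -> mpoly n int} :=
  (comp_mpoly [tuple mesym n int i.+1 | i < n]) \o
  (comp_mpoly [tuple if unlift ord_max i is Some j then 'X_j else 0 | i < n.+1]).
apply: (mpoly_morph_ext (g := f)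
  (f := comp_mpoly [tuple mesym n int i.+1 | i < n.+1])) => i /=.
rewrite !comp_mpolyXU -!tnth_nth !tnth_mktuple.
case: unliftP => [j|] ->.
  by rewrite comp_mpolyXU -tnth_nth tnth_mktuple lift_max.
by rewrite rmorph0 mesym_geqnE.
Qed.

Lemma eval_mesym_widen k n m (km : (k <= m)%N) (t : mpoly k int) :
  eval_mesym n t = eval_mesym n (t \mPo [tuple 'X_(widen_ord km i) | i < k]).
Proof.
pose f : {rmorphism mpoly k int -> mpoly n int} :=
  (comp_mpoly [tuple mesym n int i.+1 | i < m]) \o
  (comp_mpoly [tuple 'X_(widen_ord km i) | i < k]).
apply: (mpoly_morph_ext (g := f)
  (f := comp_mpoly [tuple mesym n int i.+1 | i < k])) => i /=.
by rewrite !comp_mpolyXU -!tnth_nth !tnth_mktuple comp_mpolyXU -tnth_nth tnth_mktuple.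
Qed.

(* The weight bound makes the last variable absent from [t]. *)
Lemma eval_mesym_weight n N (t : mpoly n.+1 int) : (mweight t <= n.+1)%N ->
  eval_mesym N t = eval_mesym N (truncate t).
Proof.
move=> wt; pose f : {rmorphism mpoly n.+1 int -> mpoly N int} :=
  (comp_mpoly [tuple mesym N int i.+1 | i < n]) \o
  (comp_mpoly [tuple if unlift ord_max i is Some j then 'X_j else 0 | i < n.+1]).
apply: (mpoly_morph_ext_supp (g := f)
  (f := comp_mpoly [tuple mesym N int i.+1 | i < n.+1])) => m mt.
have m0 : m ord_max = 0%N.
  apply/eqP; rewrite -leqn0 -ltnS.
  have := leq_trans (mmeasure_mnm_lt (Measure.clone _ mnmwgt _) mt) wt; rewrite /= /mnmwgt.
  rewrite (bigD1 ord_max) //= ltnS => /(leq_trans (leq_addr _ _)).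
  by case: (m ord_max) => // a; rewrite mulSn addSn ltnNge leq_addr.
rewrite mpolyXE_id !rmorph_prod /=; apply: eq_bigr => i _.
rewrite !rmorphXn /= !comp_mpolyXU -!tnth_nth !tnth_mktuple.
case: unliftP => [j|] ->; last by rewrite m0 !expr0.
by rewrite comp_mpolyXU -tnth_nth tnth_mktuple lift_max.
Qed.

(** The degree bound d makes d elementary functions suffice. Beyond d variables the weight bound
    excludes e_(m+1), so uniqueness in m variables forces the same expression in m+1 variables;
    below d, truncation gives it. *)
Lemma symmetric_function_fundamental f : symmetric_function f ->
  exists d (t : mpoly d int), forall n, f n = eval_mesym n t.
Proof.
move=> [fs ft [d fd]]; have [t [et _]] := sym_fundamental (fs d).
exists d, t => n; have [nd|dn] := leqP n d.
  rewrite -(subKn nd); elim: (d - n)%N => [|k IH]; first by rewrite subn0 -et.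
  have [kd|dk] := ltnP k d.
    by rewrite -subnSK // in IH; rewrite -ft IH truncate_eval_mesym.
  by have -> : (d - k.+1 = d - k)%N by lia.
rewrite -(subnKC (ltnW dn)); elim: (n - d)%N => [|k IH].
  by rewrite addn0 -et.
set m := (d + k)%N in IH *; rewrite addnS -/m.
have [t' [et' wt']] := sym_fundamental (fs m.+1).
have wt : (mweight t' <= m.+1)%N.
  by rewrite (leq_trans wt') // (leq_trans (fd _)) // leqW // leq_addr.
have dm : (d <= m)%N by rewrite leq_addr.
have e1 : eval_mesym m (truncate t') = eval_mesym m (t \mPo [tuple 'X_(widen_ord dm i) | i < d]).
  by rewrite -eval_mesym_truncate -eval_mesym_widen -IH -ft -et' truncate_eval_mesym.
have e2 := msym_fundamental_un e1.
by rewrite -et' -/(eval_mesym m.+1 t') eval_mesym_weight // e2 -eval_mesym_widen.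
Qed.

End SymmetricFunctions.

(** * Adams operations as ring morphisms *)

Section Adams.
Variable V : choiceType.
Local Notation D := {malg int[{cmonom V}]}.
Local Notation seqs := (nat -> D).

Definition mon_exp r (m : {cmonom V}) : D := << m >> ^+ r.

Lemma mon_exp_mmorphism r : mmorphism (mon_exp r).
Proof.
split=> [m m'|]; rewrite /mon_exp; last by rewrite -/(1 : D) expr1n.
have -> : << mmul m m' >> = << m >> * << m' >> :> D.
  by rewrite malgM_def fgmulUU mulr1.
by rewrite exprMn.
Qed.

HB.instance Definition _ r :=
  monalg.isMultiplicative.Build {cmonom V} D (mon_exp r) (mon_exp_mmorphism r).

Definition adams_poly r : {rmorphism D -> D} := monalg.mmap intr (mon_exp r).

Lemma adams_polyU r m : adams_poly r << m >> = << m >> ^+ r.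
Proof. by rewrite /adams_poly /= monalg.mmapU mul1r. Qed.

Lemma malg_morph_ext (S : zmodType) (f g : {additive D -> S}) :
  (forall m, f << m >> = g << m >>) -> f =1 g.
Proof.
move=> fg p; rewrite [p]monalgE !raddf_sum /=; apply: eq_bigr => m _.
have e (c : int) : << c *g m >> = (<< m >> : D) *~ c.
  by rewrite -[c in LHS]intz; apply: (raddfMz (mkmalgU m : int -> D)).
by rewrite e !raddfMz /= fg.
Qed.

Lemma adams_poly1 p : adams_poly 1%N p = p.
Proof.
by apply: (malg_morph_ext (f := adams_poly 1%N) (g := idfun)) => m;
  rewrite [LHS]adams_polyU.
Qed.

Lemma adams_polyM r s p : adams_poly r (adams_poly s p) = adams_poly (r * s)%N p.
Proof.
apply: (malg_morph_ext (f := adams_poly r \o adams_poly s)) => m /=.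
by rewrite !adams_polyU rmorphXn /= adams_polyU exprM.
Qed.

Lemma adamsB r : {morph @adams V r : F G / F - G}.
Proof. by move=> F G; apply: funext => n; apply: (raddfB (adams_poly r)). Qed.
Lemma adamsM r : {morph @adams V r : F G / F * G}.
Proof. by move=> F G; apply: funext => n; apply: (rmorphM (adams_poly r)). Qed.
Lemma adams1 r : @adams V r 1 = 1.
Proof. by apply: funext => n; apply: (rmorph1 (adams_poly r)). Qed.

HB.instance Definition _ r :=
  GRing.isZmodMorphism.Build seqs seqs (@adams V r) (@adamsB r).
HB.instance Definition _ r :=
  GRing.isMonoidMorphism.Build seqs seqs (@adams V r)
    (conj (adams1 r) (@adamsM r)).

Lemma malg_torsion_free (x : D) n : x *+ n.+1 = 0 -> x = 0.
Proof.
move=> h; apply/malgP => k; have := congr1 (monalg.mcoeff k) h.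
by rewrite raddfMn !raddf0 => /eqP; rewrite mulrn_eq0 => /eqP.
Qed.

End Adams.

(** * Newton's identities in each alphabet *)

Section AdamsPolySeq.
Variable K : fieldExtType rat.
Local Notation R := (poly_seq K).

Definition psi r : {rmorphism R -> R} := @adams (variables K) r.

Definition level n (x : R) : multi_poly K := x n.
Lemma levelB n : {morph level n : x y / x - y}. Proof. by []. Qed.
Lemma levelM n : {morph level n : x y / x * y}. Proof. by []. Qed.
HB.instance Definition _ n :=
  GRing.isZmodMorphism.Build R (multi_poly K) (level n) (@levelB n).
HB.instance Definition _ n :=
  GRing.isMonoidMorphism.Build R (multi_poly K) (level n)
    (conj (erefl _) (@levelM n)).

Lemma poly_seq_torsion_free (x : R) n : x *+ n.+1 = 0 -> x = 0.
Proof.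
move=> h; apply: funext => i; apply: (@malg_torsion_free _ _ n).
by have := congr1 (level i) h; rewrite raddfMn.
Qed.

Lemma psi1 (x : R) : psi 1%N x = x.
Proof. by apply: funext => n; apply: adams_poly1. Qed.

Lemma psiM m n (x : R) : psi m (psi n x) = psi (m * n)%N x.
Proof. by apply: funext => i; apply: adams_polyM. Qed.

Lemma newton_level N (a : nat -> R) (G : {poly R}) :
  (forall n, newton N (fun k => level n (a k)) (map_poly (level n) G)) ->
  newton N a G.
Proof.
move=> h k kN; apply: funext => n; have := h n k kN.
have -> : ghost_poly N (fun k => level n (a k)) = map_poly (level n) (ghost_poly N a).
  apply/polyP => i; rewrite coef_map !coef_ghost_poly.
  by case: ifP => // _; rewrite rmorph0.
by rewrite deriv_map -(map_polyX (level n)) -!rmorphM !coef_map.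
Qed.

Definition elementary q m : R := in_alphabet q (fun n => mesym n int m).

Definition power_series q N : {poly R} :=
  \poly_(m < N.+1) ((-1) ^+ m * elementary q m).

Lemma level_elementary q m n : level n (elementary q m) =
  \sum_(h : {set 'I_n} | #|h| == m) \prod_(i in h) variable q i.
Proof.
rewrite /level /elementary /in_alphabet /mesym raddf_sum /=.
apply: eq_bigr => h _; rewrite rmorph_prod /=; apply: eq_bigr => i _.
by rewrite mpoly.mmapX mmap1U.
Qed.

Lemma level_variable_sum q n :
  level n (in_alphabet q variable_sum) = \sum_(i < n) variable q i.
Proof.
rewrite /level /in_alphabet /variable_sum raddf_sum /=.
by apply: eq_bigr => i _; rewrite mpoly.mmapX mmap1U.
Qed.

Lemma level_psi_variable_sum q k n :
  level n (psi k (in_alphabet q variable_sum)) = \sum_(i < n) variable q i ^+ k.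
Proof.
have -> : level n (psi k (in_alphabet q variable_sum)) =
  adams_poly _ k (level n (in_alphabet q variable_sum)) by [].
rewrite level_variable_sum raddf_sum /=; apply: eq_bigr => i _.
exact: adams_polyU.
Qed.

(** At level n the series is the truncation of the product of the 1 - x_i X, whose ghost components
    are minus the power sums. *)
Lemma newton_elementary q N : newton N
  (fun k => - psi k (in_alphabet q variable_sum)) (power_series q N).
Proof.
apply: newton_level => n.
pose P (s : seq 'I_n) : {poly multi_poly K} := \prod_(i <- s) (1 - variable q i *: 'X^1).
have h (s : seq 'I_n) : newton N (fun k => - \sum_(i <- s) variable q i ^+ k) (P s).
  rewrite /P; elim: s => [|i s IH].
    move=> k _; rewrite big_nil -polyC1 derivC mulr0 mulr1 coef_ghost_poly coef0.
    by rewrite big_nil oppr0 if_same.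
  rewrite big_cons.
  apply: eq_newton (newtonM (newton_bracketN (variable q i) (ltn0Sn 0)) IH).
  by move=> k _ /=; rewrite /bracket dvd1n divn1 mulr1n big_cons opprD.
apply: (newton_eqm (G := P (index_enum 'I_n))); last first.
  apply: eq_newton (h _) => k _; apply/esym.
  by rewrite raddfN /= level_psi_variable_sum.
move=> m mN; rewrite coef_map /= coef_poly ltnS mN rmorphM rmorphXn rmorphN1 /=.
rewrite level_elementary /P.
under eq_bigr => i _ do rewrite -scaleNr addrC.
rewrite bigA_distr coef_sum mulr_sumr [RHS]big_mkcond.
apply: eq_bigr => J _.
have -> : \prod_i (if i \in J then - variable q i *: 'X^1 else 1) =
   ((-1) ^+ #|J| * \prod_(i in J) variable q i) *: 'X^#|J| :> {poly multi_poly K}.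
  by rewrite -big_mkcond /= scaler_prod prodrN prodr_const.
rewrite coefZ coefXn [m == _]eq_sym; case: eqP => [->|_]; first by rewrite mulr1.
by rewrite mulr0.
Qed.
End AdamsPolySeq.
Arguments psi {K} r.

(** * Existence of the operations h_r on A_K *)

Section Plethysm.
Variable K : fieldExtType rat.
Local Notation R := (poly_seq K).
Local Notation tf := (@poly_seq_torsion_free K).
Implicit Types (F G : AK K) (J T : R -> Prop).

Definition inAK (x : R) : Prop := x \in @AK_pred K.

Lemma inAK_subring : is_subring inAK.
Proof.
have [A1 AB AM] := @AK_pred_subring K; do 2!split=> //.
by rewrite -(subrr 1); apply: AB.
Qed.

Lemma elementary_inAK q m : inAK (elementary q m).
Proof.
apply: mem_generated_subring; exists q, (fun n => mesym n int m).
by split=> //; apply: mesym_symmetric_function.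
Qed.

Lemma AK_generated T : is_subring T -> (forall q m, T (elementary q m)) ->
  forall x, inAK x -> T x.
Proof.
move=> [T1 cT] Te x /asboolP Ax; case: (cT) => T0 TB TM.
pose S : {pred R} := fun x => `[<T x>].
apply/asboolP; apply: (Ax S).
  by split=> [|a b /asboolP Ta /asboolP Tb|a b /asboolP Ta /asboolP Tb];
    apply/asboolP; auto.
move=> _ [q [f [fs ->]]]; apply/asboolP.
have [d [t ft]] := symmetric_function_fundamental fs.
suff -> : in_alphabet q f =
    mpoly.mmap (intr : int -> R) (fun i : 'I_d => elementary q i.+1) t.
  rewrite /mpoly.mmap; apply: (nu_sum (J := T)) => // m _; apply: (TM _ _).
    exact: (subring_int (B := T) _ (conj T1 cT)).
  rewrite /mmap1; apply: (big_ind T T1 TM) => i _; exact: (subring_exp (B := T) _ (conj T1 cT)).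
apply: funext => n.
pose f1 : {rmorphism mpoly d int -> multi_poly K} :=
  (mpoly.mmap intr (fun i : 'I_n => variable q i))
    \o (comp_mpoly [tuple mesym n int i.+1 | i < d]).
pose f2 : {rmorphism mpoly d int -> multi_poly K} :=
  (@level K n) \o (mpoly.mmap (intr : int -> R) (fun i : 'I_d => elementary q i.+1)).
rewrite /in_alphabet ft; apply: (mpoly_morph_ext (f := f1) (g := f2)) => i.
rewrite /f1 /f2 /= comp_mpolyXU -tnth_nth tnth_mktuple.
by rewrite mpoly.mmapX mmap1U.
Qed.

(** Uniqueness of the series identifies its coefficients with the signed elementary functions. Hence
    A_K is the smallest subring over which all alphabets are expressible, as [lambda_closed]
    demands. *)
Lemma elementary_expressible T q : is_subring T ->
  (forall N, expressible N T (fun k => - psi k (in_alphabet q variable_sum))) ->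
  forall m, T (elementary q m).
Proof.
move=> [T1 cT] h m; have [G [G0 TG] nG] := h m.
have e0 : (power_series q m)`_0 = G`_0.
  rewrite G0 coef_poly expr0 mul1r; apply: funext => n.
  by rewrite -[LHS]/(in_alphabet q _ n) /in_alphabet mesym0E rmorph1.
have := newton_uniq tf (@newton_elementary K q m) nG e0 (leqnn m).
rewrite coef_poly ltnSn => /(congr1 (fun x => (-1) ^+ m * x)).
rewrite mulrA -exprMn mulrNN mulr1 expr1n mul1r => ->.
have [T0 _ TM] := cT; apply: TM.
  exact: (subring_exp _ (conj T1 cT) (nuN cT T1)).
by case: (m) => [|k]; rewrite ?G0.
Qed.

Lemma alphabet_expressible q N :
  expressible N inAK (fun k => psi k (in_alphabet q variable_sum)).
Proof.
have [_ cA] := inAK_subring; have [_ _ AM] := cA.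
have h : expressible N inAK (fun k => - psi k (in_alphabet q variable_sum)).
  exists (power_series q N); last exact: newton_elementary.
  split.
    rewrite coef_poly expr0 mul1r; apply: funext => n.
    by rewrite -[LHS]/(in_alphabet q _ n) /in_alphabet mesym0E rmorph1.
  move=> n; rewrite coef_poly; case: ifP => _; last by case: cA.
  apply: AM; last exact: elementary_inAK.
  have [A1 _] := inAK_subring; exact: (subring_exp _ inAK_subring (nuN cA A1)).
by apply: eq_expressible (expressibleN cA h) => n _; rewrite opprK.
Qed.

Lemma AK_expressible F N : expressible N inAK (fun k => psi k (AKval F)).
Proof.
apply: (lambda_closed tf (@psi1 K) (@psiM K) inAK_subring
  (W := fun w => exists q, w = in_alphabet q variable_sum)) (AKvalP F) N.
  by move=> _ [q ->] N; apply: alphabet_expressible.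
move=> T cT Tw; apply: AK_generated => // q; apply: elementary_expressible => // N.
by apply: expressibleN; [case: cT | apply: Tw; exists q].
Qed.

Lemma AKval_inj : injective (@AKval K).
Proof. exact: val_inj. Qed.

Lemma plethysm_hE r F (G : {poly R}) : newton r (fun k => psi k (AKval F)) G ->
  G`_0 = 1 -> AKval (plethysm_h r F) = G`_r.
Proof.
move=> nG G0; have [H AH nH] := AK_expressible F r.
have HG := newton_uniq tf nH nG (etrans (proj1 AH) (esym G0)).
have AHr : inAK H`_r by apply: (one_plus_coef _ AH); exact: inAK_subring.
have e := newton_expansion tf nH (proj1 AH).
(* The coefficient of [H] shows that the set is nonempty, so the default value 0 never occurs. *)
rewrite /plethysm_h; case: xgetP => [G' _ eG'|/(_ (MkAK AHr)) []].
  rewrite -HG //; apply: (mulrnI_tf tf (n := r`!)); first exact: fact_gt0.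
  by rewrite e; apply: eG'.
exact: e.
Qed.

End Plethysm.

(** * The class ring as a quotient lambda-ring *)

Section ClassRing.
Variable K : fieldExtType rat.
Local Notation R := (poly_seq K).
Local Notation tf := (@poly_seq_torsion_free K).

Definition AK_emb : {rmorphism AK K -> R} := @AKval K.

Lemma AK_image_expressible (F : AK K) N :
  expressible N (image_of (AK_emb) xpredT) (fun k => psi k (AK_emb F)).
Proof.
have [G [G0 AG] nG] := AK_expressible F N; exists G => //; split=> // n.
by exists (MkAK (AG n)).
Qed.

Lemma AK_emb_inj : injective AK_emb.
Proof. exact: AKval_inj. Qed.

Lemma AK_emb_h r F (G : {poly R}) : newton r (fun k => psi k (AK_emb F)) G ->
  G`_0 = 1 -> AK_emb (plethysm_h r F) = G`_r.
Proof. exact: plethysm_hE. Qed.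

Lemma constant_coef_psi n (x : R) : (0 < n)%N ->
  constant_coef (psi n x) = constant_coef x.
Proof. exact: constant_coef_adams. Qed.

Let U (u : AK K) := exists2 alpha : K, alpha != 0 &
  u = \sum_(q <- finsupp (valuations (principal alpha)))
        alphabet_sum q *~ valuations (principal alpha) q.

Lemma constant_coef_U u : U u -> constant_coef (AK_emb u) = 0.
Proof.
move=> [alpha _ ->]; rewrite !raddf_sum big1 // => q _.
by rewrite !raddfMz /= constant_coef_alphabet_sum mul0rz.
Qed.

Lemma PK_generated : @PK K =
  generated_ideal [set G | exists m u, [/\ (0 < m)%N, U u & G = plethysm_h m u]]%classic.
Proof.
congr generated_ideal; apply/seteqP; split=> G.
  move=> [m [alpha [m0 alpha0 ->]]]; exists m.
  exists (\sum_(q <- finsupp (valuations (principal alpha)))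
    alphabet_sum q *~ valuations (principal alpha) q).
  by split; [exact: m0 | exists alpha | rewrite /Hpoly].
move=> [m [_ [m0 [alpha alpha0 ->] ->]]]; exists m, alpha.
by split; [exact: m0 | exact: alpha0 | rewrite /Hpoly].
Qed.

Lemma class_pi_eq F G : class_pi F = class_pi G <-> F - G \in @PK K.
Proof.
by rewrite Quotient.idealrBE; split=> [h|/eqP //]; apply/eqP.
Qed.

Lemma class_hE r (F : AK K) : class_h r (class_pi F) = class_pi (plethysm_h r F).
Proof.
apply/class_pi_eq; apply: (h_congr AK_emb_inj tf (@psi1 K) (@psiM K)
  AK_emb_h AK_image_expressible constant_coef_psi constant_coef_U
  PK_generated).
by apply/class_pi_eq; rewrite /class_pi reprK.
Qed.

Lemma class_ring_generated (s : seq (prime_ideals K)) :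
  (forall q, exists2 l, {subset l <= s} &
     U (alphabet_sum q + \sum_(p <- l) alphabet_sum p)) ->
  finitely_generated_lambda (@class_h K).
Proof.
pose pi : {rmorphism AK K -> class_ring K} := \pi_({ideal_quot (@PK K)})%qT.
have pi_surj x : exists F, x = pi F.
  by exists (repr (x : {ideal_quot @PK K})); rewrite /pi /= reprK.
have pi_P F : F \in @PK K -> pi F = 0.
  by move=> PF; rewrite -(rmorph0 pi); apply/class_pi_eq; rewrite subr0.
apply: (quotient_generated AK_emb_inj AK_emb_h AK_image_expressible
  PK_generated pi_surj pi_P class_hE (X := @alphabet_sum K)) => T cT TX F.
apply: AK_generated (AKvalP F) => // q; apply: elementary_expressible => // N.
by apply: expressibleN; [case: cT | exact: TX].
Qed.

End ClassRing.

(** * The norm and Hurwitz's lemma *)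

Section Integers.
Variable K : fieldExtType rat.
Local Notation OK := (@ring_of_integers K).

Lemma OK_int (z : int) : OK z%:~R. Proof. exact: integral_id. Qed.
Lemma OK_nat n : OK n%:R. Proof. exact: integral_nat. Qed.
Lemma OK0 : OK 0. Proof. exact: integral0. Qed.
Lemma OK1 : OK 1. Proof. exact: integral1. Qed.
Lemma OKB x y : OK x -> OK y -> OK (x - y). Proof. exact: integral_sub. Qed.
Lemma OKN x : OK x -> OK (- x). Proof. exact: integral_opp. Qed.
Lemma OKD x y : OK x -> OK y -> OK (x + y). Proof. exact: integral_add. Qed.
Lemma OKM x y : OK x -> OK y -> OK (x * y). Proof. exact: integral_mul. Qed.
Lemma OKX x n : OK x -> OK (x ^+ n).
Proof. by move=> Ox; elim: n => [|n IH]; rewrite ?exprS; [apply: OK1 | apply: OKM]. Qed.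
Lemma OK_sum (I : Type) (r : seq I) (P : pred I) F :
  (forall i, P i -> OK (F i)) -> OK (\sum_(i <- r | P i) F i).
Proof. by move=> h; apply: (big_ind OK) => //; [apply: OK0 | apply: OKD]. Qed.

Lemma natK_neq0 n : (n.+1%:R : K) != 0.
Proof.
have -> : (n.+1%:R : K) = (n.+1%:R : rat)%:A by rewrite scaler_nat.
by rewrite scaler_eq0 oner_eq0 orbF pnatr_eq0.
Qed.

(** x is a root of X^j - X^i - w, which is monic with integral coefficients. *)
Lemma OK_monic x i j : (i < j)%N -> OK (x ^+ j - x ^+ i) -> OK x.
Proof.
move=> ij Ow; set w := x ^+ j - x ^+ i in Ow.
pose q : {poly K} := 'X^i + w%:P.
have sq : (size (- q) < size ('X^j : {poly K}))%N.
  rewrite size_polyN size_polyXn ltnS (leq_trans (size_polyD _ _)) //.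
  by rewrite size_polyXn geq_max ij (leq_trans (size_polyC_leq1 _)) // (leq_ltn_trans _ ij).
apply: (@integral_root_monic _ _ _ x ('X^j - q)).
- by rewrite monicE lead_coefDl // lead_coefXn.
- rewrite rootE /q !(hornerD, hornerN, hornerXn, hornerC) /w; apply/eqP; ring.
- apply/integral_poly => k; rewrite coefB /q coefD !coefXn coefC.
  by apply: OKB; [apply: OK_nat | apply: OKD; [apply: OK_nat |]]; case: eqP => // _; apply: OK0.
Qed.

Local Notation n := (\dim {:K}).
Local Notation b := (vbasis {:K}).

Definition mult_mx (x : K) : 'M[rat]_n := \matrix_(i, j) coord b i (b`_j * x).

Lemma vbasis_sum (x : K) : x = \sum_i coord b i x *: b`_i.
Proof. exact/coord_vbasis/memvf. Qed.

Lemma mult_mxM x y : mult_mx (x * y) = mult_mx y *m mult_mx x.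
Proof.
apply/matrixP => i j; rewrite !mxE mulrA {1}[b`_j * x]vbasis_sum mulr_suml raddf_sum /=.
by apply: eq_bigr => k _; rewrite !mxE -scalerAl linearZ /= mulrC.
Qed.

Lemma mult_mxD x y : mult_mx (x + y) = mult_mx x + mult_mx y.
Proof. by apply/matrixP => i j; rewrite !mxE mulrDr linearD. Qed.

Lemma mult_mxZ a x : mult_mx (a *: x) = a *: mult_mx x.
Proof. by apply/matrixP => i j; rewrite !mxE -scalerAr linearZ. Qed.

Lemma mult_mx0 : mult_mx 0 = 0.
Proof. by apply/matrixP => i j; rewrite !mxE mulr0 linear0. Qed.

Lemma mult_mx_sum (I : Type) (r : seq I) (F : I -> K) :
  mult_mx (\sum_(i <- r) F i) = \sum_(i <- r) mult_mx (F i).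
Proof.
by elim: r => [|i r IH]; rewrite ?big_nil ?mult_mx0 // !big_cons mult_mxD IH.
Qed.

Lemma mult_mx1 : mult_mx 1 = 1%:M.
Proof.
apply/matrixP => i j; rewrite !mxE mulr1.
by rewrite coord_free 1?eq_sym // (basis_free (vbasisP _)).
Qed.

Lemma dimK_gt0 : (0 < n)%N.
Proof. by rewrite adim_gt0. Qed.

Lemma common_denominator (I : finType) (a : I -> rat) :
  exists2 d : nat, (0 < d)%N & forall i, exists z : int, a i *+ d = z%:~R.
Proof.
pose d := (\prod_i `|denq (a i)|)%N.
have d0 : (0 < d)%N by apply: prodn_gt0 => i; rewrite absz_gt0 denq_neq0.
exists d => // i; rewrite /d (bigD1 i) //= mulrnA.
have -> : a i *+ `|denq (a i)| = (numq (a i))%:~R.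
  rewrite numqE -mulr_natr pmulrn; congr (_ * _%:~R).
  exact: gez0_abs (denq_ge0 _).
by exists (numq (a i) *+ (\prod_(j | j != i) `|denq (a j)|)%N); rewrite rmorphMn.
Qed.

(** The row of basis vectors is an eigenvector, with eigenvalue d x, of the integer matrix d *
    [mult_mx x], whose characteristic polynomial is monic. *)
Lemma OK_multiple x : exists2 d : nat, (0 < d)%N & OK (d%:R * x).
Proof.
have [d d0 dM] := common_denominator (fun ij : 'I_n * 'I_n => mult_mx x ij.1 ij.2).
exists d => //; have [z zE] := choice dM.
pose B : 'M[int]_n := \matrix_(i, j) z (i, j).
pose BK : 'M[K]_n := map_mx intr B.
exists (char_poly B); first exact: char_poly_monic.
rewrite map_char_poly -/BK -eigenvalue_root_char; apply/eigenvalueP.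
exists (\row_i b`_i).
  apply/rowP => j; rewrite !mxE.
  have e : b`_j * x = \sum_i mult_mx x i j *: b`_i.
    by rewrite [LHS]vbasis_sum; apply: eq_bigr => i _; rewrite mxE.
  rewrite -mulrA [x * _]mulrC e.
  rewrite mulr_sumr; apply: eq_bigr => i _; rewrite !mxE.
  by have /= := zE (i, j); rewrite mxE mulr_natl scalerMnl => ->; rewrite scaler_int mulrzr.
apply/eqP => /rowP h.
have : (1 : K) = 0.
  rewrite [1]vbasis_sum big1 // => i _; have := h i; rewrite !mxE => ->.
  by rewrite scaler0.
by move/eqP; rewrite oner_eq0.
Qed.

Definition norm (x : K) : rat := \det (mult_mx x).

Lemma normM x y : norm (x * y) = norm x * norm y.
Proof. by rewrite /norm mult_mxM det_mulmx mulrC. Qed.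

Lemma norm_neq0 x : x != 0 -> norm x != 0.
Proof.
move=> x0; have : norm x * norm x^-1 = 1.
  by rewrite -normM mulfV // /norm mult_mx1 det1.
by apply: contra_eq_neq => ->; rewrite mul0r eq_sym oner_neq0.
Qed.

Lemma mult_mx_eigenvalue x (l : algC) (p : {poly int}) :
  eigenvalue (map_mx ratr (mult_mx x)) l ->
  root (map_poly intr p) x -> root (map_poly intr p) l.
Proof.
move=> /eigenvalueP[v vl v0] /rootP px.
have vX k : v *m map_mx ratr (mult_mx (x ^+ k)) = l ^+ k *: v.
  elim: k => [|k IH]; first by rewrite !expr0 mult_mx1 map_mx1 mulmx1 scale1r.
  by rewrite exprS mult_mxM map_mxM mulmxA IH -scalemxAl vl scalerA exprSr.
have : v *m map_mx ratr (mult_mx (map_poly intr p).[x]) = (map_poly intr p).[l] *: v.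
  rewrite (@horner_coef_wide _ (size p)) ?size_poly //.
  rewrite (@horner_coef_wide _ (size p) _ l) ?size_poly // mult_mx_sum.
  rewrite scaler_suml map_mx_sum mulmx_sumr; apply: eq_bigr => i _.
  rewrite !coef_map /=.
  have -> : (p`_i)%:~R * x ^+ i = ((p`_i)%:~R : rat) *: x ^+ i by rewrite scaler_int mulrzl.
  by rewrite mult_mxZ map_mxZ -scalemxAr vX scalerA /= ratr_int.
rewrite px mult_mx0 map_mx0 mulmx0 => /esym/eqP; rewrite scaler_eq0 (negPf v0) orbF.
by rewrite -rootE.
Qed.

(** The determinant is a product of eigenvalues in [algC], which are algebraic integers since x is;
    a rational algebraic integer is an integer. *)
Lemma norm_int x : OK x -> exists z : int, norm x = z%:~R.
Proof.
move=> [p mp px].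
have Anorm : (ratr (norm x) : algC) \in Aint.
  rewrite /norm -det_map_mx; set A := map_mx _ _.
  have [r er] := closed_field_poly_normal (char_poly A).
  rewrite (monicP (char_poly_monic A)) scale1r in er.
  have -> : \det A = (-1) ^+ n * (char_poly A)`_0.
    by rewrite char_poly_det mulrA -exprMn mulrNN mulr1 expr1n mul1r.
  rewrite -horner_coef0 er horner_prod rpredM ?rpredX ?rpredN ?rpred1 //.
  rewrite big_seq rpred_prod // => l lr; rewrite !hornerE rpredN.
  apply: (@root_monic_Aint (map_poly intr p)).
  - apply: mult_mx_eigenvalue px; rewrite -/A eigenvalue_root_char er.
    by rewrite root_prod_XsubC.
  - by rewrite monic_map.
  - by apply/polyOverP => i; rewrite coef_map /= intr_int.
have : (ratr (norm x) : algC) \in Num.int by apply: Cint_rat_Aint => //; apply: Crat_rat.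
by move=> /intrP[z e]; exists z; apply: (fmorph_inj (ratr : rat -> algC)); rewrite /= e ratr_int.
Qed.

Lemma det_small k (A : 'M[rat]_k) d : (0 < k)%N -> 0 <= d <= 1 ->
  (forall i j, `|A i j| <= d) -> `|\det A| <= (k`!)%:R * d.
Proof.
move=> k0 /andP[d0 d1] Ad; rewrite (le_trans (ler_norm_sum _ _ _)) //.
have -> : (k`!)%:R * d = \sum_(s : 'S_k) d.
  by rewrite sumr_const mulr_natl card_Sn.
apply: ler_sum => s _; rewrite normrM normrX normrN1 expr1n mul1r normr_prod.
apply: (@le_trans _ _ (d ^+ k)).
  rewrite -[X in _ <= _ ^+ X]card_ord -prodr_const; apply: ler_prod => i _.
  by rewrite normr_ge0 Ad.
by case: (k) k0 => // j _; rewrite exprS ler_piMr // exprn_ile1.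
Qed.

(* Hurwitz: pigeonhole on the fractional parts of the coordinates of the
   multiples of [x]. *)
Lemma hurwitz : exists2 M : nat, (0 < M)%N & forall x : K, exists t w,
  [/\ (0 < t <= M)%N, OK w & `|norm (t%:R * x - w)| < 1].
Proof.
have /choice[d dE] (i : 'I_n) : exists d : nat, (0 < d)%N /\ OK (d%:R * b`_i).
  by have [d d0 Od] := OK_multiple b`_i; exists d.
pose c i := (d i)%:R * b`_i.
pose C := \sum_k \sum_i \sum_j `|mult_mx (c k) i j|.
have C0 : 0 <= C by do 3!apply: sumr_ge0 => ? _.
(* Coordinates of size at most 1/m give matrix entries of size at most C/m <= 1/(n!+1), hence a
   determinant below n!/(n!+1) < 1. *)
pose m := (Num.truncn (C * (n`!).+1%:R)).+1.
have mC : C * (n`!).+1%:R < m%:R by apply: truncnS_gt.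
have m0 : 0 < (m%:R : rat) by rewrite ltr0n.
have small (y : 'I_n -> rat) : (forall i, `|y i| <= m%:R^-1) ->
    `|norm (\sum_i y i *: c i)| < 1.
  move=> hy; have F0 : 0 < ((n`!).+1%:R : rat) by rewrite ltr0n.
  have Cm : C / m%:R <= (n`!).+1%:R^-1.
    by rewrite ler_pdivrMr // ler_pdivlMl // mulrC ltW.
  apply: (@le_lt_trans _ _ ((n`!)%:R * (n`!).+1%:R^-1)); last first.
    by rewrite ltr_pdivrMr // mul1r ltr_nat.
  apply: det_small; first exact: dimK_gt0.
    by rewrite invr_ge0 ltW //= invf_le1 // ler1n.
  move=> i j; apply: le_trans Cm; rewrite mult_mx_sum summxE.
  rewrite (le_trans (ler_norm_sum _ _ _)) // /C mulr_suml; apply: ler_sum => k _.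
  rewrite mult_mxZ mxE normrM mulrC ler_pM // (bigD1 i) //= (bigD1 j) //=.
  rewrite -addrA lerDl addr_ge0 //; first by apply: sumr_ge0.
  by do 2!apply: sumr_ge0 => ? _.
pose coo x i : rat := coord b i x / (d i)%:R.
have cooE x : x = \sum_i coo x i *: c i.
  rewrite {1}[x]vbasis_sum; apply: eq_bigr => i _; rewrite /c /coo mulr_natl.
  by rewrite -scaler_nat scalerA divfK // pnatr_eq0 -lt0n (dE i).1.
(* There are m^n boxes for the m^n + 1 multiples 0, x, ..., m^n x. *)
exists (m ^ n)%N; first by rewrite expn_gt0.
move=> x; pose fr (j : nat) i := coo x i *+ j - (Num.floor (coo x i *+ j))%:~R.
have fr0 j i : 0 <= fr j i by rewrite subr_ge0 floor_le.
have fr1 j i : fr j i < 1.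
  by rewrite ltrBlDr addrC; have := floorD1_gt (coo x i *+ j); rewrite rmorphD.
have cellP j i : (Num.truncn (m%:R * fr j i) < m)%N.
  by rewrite truncn_lt_nat ?mulr_ge0 // gtr_pMr.
pose cell (j : 'I_(m ^ n).+1) : {ffun 'I_n -> 'I_m} :=
  [ffun i => Ordinal (cellP j i)].
have /injectivePn[j1 [j2 j12 ce]] : ~~ injectiveb cell.
  apply/injectiveP => /leq_card; rewrite card_ffun !card_ord.
  by rewrite ltnn.
have [k1 [k2 [k12 kM ke]]] : exists k1 k2 : nat, [/\ (k1 < k2)%N, (k2 <= m ^ n)%N &
   forall i, Num.truncn (m%:R * fr k1 i) = Num.truncn (m%:R * fr k2 i)].
  have ce' i : Num.truncn (m%:R * fr j1 i) = Num.truncn (m%:R * fr j2 i).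
    by have := congr1 (fun f : {ffun 'I_n -> 'I_m} => val (f i)) ce; rewrite !ffunE.
  case: (ltngtP j1 j2) => [j|j|/val_inj e]; last by rewrite e eqxx in j12.
    by exists j1, j2; rewrite j -ltnS ltn_ord.
  by exists j2, j1; split=> [||i]; [exact: j | exact: (ltn_ord j1) | rewrite ce'].
pose w := \sum_i ((Num.floor (coo x i *+ k2) - Num.floor (coo x i *+ k1))%:~R : rat) *: c i.
exists (k2 - k1)%N, w; split.
- by rewrite subn_gt0 k12 (leq_trans (leq_subr _ _)).
- apply: OK_sum => i _; rewrite scaler_int -mulrzl; apply: OKM; first exact: OK_int.
  exact: (dE i).2.
have -> : (k2 - k1)%:R * x - w = \sum_i (fr k2 i - fr k1 i) *: c i.
  rewrite {1}(cooE x) mulr_sumr /w -sumrB; apply: eq_bigr => i _.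
  rewrite mulr_natl -scaler_nat scalerA -scalerBl; congr (_ *: _).
  rewrite /fr natrB ?(ltnW k12) // rmorphB /= -!(mulr_natr (coo x i)); ring.
apply: small => i.
have e2 := truncn_itv (mulr_ge0 (ltW m0) (fr0 k2 i)).
have e1 := truncn_itv (mulr_ge0 (ltW m0) (fr0 k1 i)).
rewrite ke in e1; move: e1 e2 => /andP[a1 a2] /andP[b1 b2].
rewrite -[X in _ <= X]mul1r ler_pdivlMr // -[X in _ * X](gtr0_norm m0) -normrM.
rewrite ler_norml -natr1 in a2 b2 *; apply/andP; split; lra.
Qed.

End Integers.

(** * Ideals *)

Section FiniteQuotients.
Variable K : fieldExtType rat.
Local Notation OK := (@ring_of_integers K).
Local Notation n := (\dim {:K}).

Lemma integer_relation (x : 'I_n.+1 -> K) :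
  exists2 c : 'I_n.+1 -> int, \sum_i (c i)%:~R * x i = 0 & exists i, c i != 0.
Proof.
pose S : 'M[rat]_(n.+1, n) := \matrix_(i, j) coord (vbasis {:K}) j (x i).
have : kermx S != 0.
  rewrite -mxrank_eq0 mxrank_ker subn_eq0 -ltnNge ltnS.
  exact: rank_leq_col.
case/rowV0Pn => u /sub_kermxP uS u0.
have [d d0 dM] := common_denominator (fun i => u 0 i).
have [c cE] := choice dM; exists c; last first.
  apply: contrapT => h; case/eqP: u0; apply/rowP => i; rewrite mxE.
  have /eqP : u 0 i *+ d = 0.
    rewrite cE; case: (eqVneq (c i) 0) => [-> //|ci]; by case: h; exists i.
  by rewrite mulrn_eq0 (gtn_eqF d0) => /eqP.
have -> : \sum_i (c i)%:~R * x i = (\sum_i u 0 i *: x i) *+ d.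
  rewrite -sumrMnl; apply: eq_bigr => i _.
  by rewrite scalerMnl cE scaler_int mulrzl.
suff -> : \sum_i u 0 i *: x i = 0 by rewrite mul0rn.
have e i : x i = \sum_j S i j *: (vbasis {:K})`_j.
  by rewrite [LHS]vbasis_sum; apply: eq_bigr => j _; rewrite mxE.
under eq_bigr => i _ do rewrite e scaler_sumr.
rewrite exchange_big big1 // => j _ /=.
under eq_bigr => i _ do rewrite scalerA.
rewrite -scaler_suml; have /rowP/(_ j) := uS; rewrite !mxE => ->.
by rewrite scale0r.
Qed.

(** Descent on the sum of the absolute values: a relation divisible by p can be divided by p. *)
Lemma primitive_relation (p : nat) (x : 'I_n.+1 -> K) : (1 < p)%N ->
  exists2 c : 'I_n.+1 -> int, \sum_i (c i)%:~R * x i = 0 &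
    exists i, ~~ (p %| c i)%Z.
Proof.
move=> p1; have [c + nz] := integer_relation x.
have [N cN] : exists N, (\sum_i `|c i| < N)%N by exists (\sum_i `|c i|).+1%N.
elim: N c nz cN => // N IH c [i ci] cN cx.
have [h|] := pselect (exists i, ~~ (p %| c i)%Z); first by exists c.
move=> /forallNP h.
have dv j : (p %| c j)%Z by apply/negPn/negP/h.
have /choice[e eE] j : exists e : int, c j = e * p.
  by have /dvdzP[e ->] := dv j; exists e.
have ei : e i != 0 by apply: contraNneq ci; rewrite eE => ->; rewrite mul0r.
apply: (IH e); first by exists i.
  apply: (@leq_trans (\sum_j `|c j|)); last by rewrite -ltnS.
  rewrite (bigD1 i) //= [leqRHS](bigD1 i) //= -addSn; apply: leq_add.
    by rewrite eE abszM /= ltn_Pmulr // absz_gt0.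
  by apply: leq_sum => j _; rewrite eE abszM /= leq_pmulr // ltnW.
have p0 : (p%:R : K) != 0 by case: (p) p1 => // k _; apply: natK_neq0.
apply: (mulIf p0); rewrite mul0r; apply: etrans cx; rewrite mulr_suml; apply: eq_bigr => j _.
by rewrite eE rmorphM /= mulrAC.
Qed.

(** The finiteness of O_K/m, witnessed by a list meeting every class. *)
Definition covers (m : nat) (s : seq K) := (forall r, r \in s -> OK r) /\
  forall x, OK x -> exists r y, [/\ r \in s, OK y & x = r + m%:R * y].

Definition independent_mod (p : nat) (s : seq K) :=
  forall (c : nat -> int) y, OK y ->
    \sum_(i < size s) (c i)%:~R * s`_i = p%:R * y ->
    forall i, (i < size s)%N -> (p %| c i)%Z.

Lemma independent_mod_size p s : (1 < p)%N -> independent_mod p s ->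
  (size s <= n)%N.
Proof.
move=> p1 ind; rewrite leqNgt; apply/negP => sn.
have [c cx [i ci]] := primitive_relation (fun i : 'I_n.+1 => s`_i) p1.
pose c' (j : nat) : int := if insub j is Some k then c k else 0.
have c'E (j : 'I_n.+1) : c' j = c j by rewrite /c' valK.
have := ind c' 0 (OK0 K); rewrite mulr0 => /(_ _ i (leq_trans (ltn_ord i) sn)).
rewrite c'E (negPf ci) => h; suff : false by []; apply: h.
apply: etrans cx; rewrite (eq_bigr (fun i : 'I_n.+1 => (c' i)%:~R * s`_i)).
  rewrite [RHS](big_ord_widen _ (fun j => (c' j)%:~R * s`_j) sn) [RHS]big_mkcond.
  apply: eq_bigr => j _; case: ifP => // jn; rewrite /c' insubF ?mul0r //.
by move=> j _; rewrite c'E.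
Qed.

(** A family independent modulo p has at most n elements; a maximal one spans O_K/p over F_p. *)
Lemma covers_prime p : prime p -> exists s, covers p s.
Proof.
move=> pp; have p1 := prime_gt1 pp; have p0 := prime_gt0 pp.
pose Q k := `[< exists s, [/\ size s = k, (forall r, r \in s -> OK r)
  & independent_mod p s] >].
have Q0 : exists k, Q k by exists 0%N; apply/asboolP; exists [::].
have Qn k : Q k -> (k <= n)%N.
  by move=> /asboolP[s [<- _ ind]]; apply: independent_mod_size ind.
case: (ex_maxnP Q0 Qn) => k /asboolP[s [sk Os ind]] kmax.
pose R := [seq \sum_(i < k) (val (e i))%:R * s`_i | e : {ffun 'I_k -> 'I_p}].
exists R; split.
  move=> _ /mapP[e _ ->]; apply: OK_sum => i _; apply: OKM; first exact: OK_nat.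
  by apply/Os/mem_nth; rewrite sk.
move=> x Ox.
have : ~ independent_mod p (rcons s x).
  move=> ind'; suff : (k.+1 <= k)%N by rewrite ltnn.
  apply: kmax; apply/asboolP; exists (rcons s x); split=> //.
    by rewrite size_rcons sk.
  by move=> r; rewrite mem_rcons inE => /orP[/eqP -> //|]; apply: Os.
move=> /existsNP[c /existsNP[y /not_implyP[Oy /not_implyP[]]]].
rewrite size_rcons sk big_ord_recr /= nth_rcons sk ltnn eqxx => cy.
move=> /existsNP[i /not_implyP[ik nci]].
have cy' : \sum_(i < k) (c i)%:~R * s`_i + (c k)%:~R * x = p%:R * y.
  rewrite -cy; congr (_ + _); apply: eq_bigr => j _.
  by rewrite nth_rcons sk ltn_ord.
(* Otherwise the term of x could be moved into p O_K, and the independence of [s] would make all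
   coefficients divisible by p. *)
have nck : ~~ (p %| c k)%Z.
  apply/negP => dk; have /dvdzP[e ek] := dk.
  case: nci; have [->//|ik'] := eqVneq i k.
  apply: (ind c (y - e%:~R * x)).
  - by apply: OKB => //; apply: OKM => //; apply: OK_int.
  - rewrite sk mulrBr -cy' ek rmorphM /= [_%:~R * p%:~R]mulrC -mulrA.
    by rewrite -[p%:~R]/(p%:R) addrK.
  - by rewrite sk ltn_neqAle ik' -ltnS.
have [u [w uw]] : exists u w : int, u * c k + w * p = 1.
  have [u [w uw]] := Bezoutz (c k) p; exists u, w; rewrite uw.
  apply/eqP; rewrite -[_ == 1]/(coprimez (c k) p) coprimezE coprime_sym prime_coprime //.
pose f j := (- (u * c j) %/ p)%Z; pose e j := (- (u * c j) %% p)%Z.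
have ee j : 0 <= e j < p by rewrite modz_ge0 ?ltz_pmod // gt_eqF.
have elt j : (`|e j| < p)%N.
  by have /andP[e0 ep] := ee j; rewrite -ltz_nat gez0_abs.
exists (\sum_(j < k) (`|e j|%N)%:R * s`_j),
  (u%:~R * y + \sum_(j < k) (f j)%:~R * s`_j + w%:~R * x); split.
- apply/mapP; exists [ffun j : 'I_k => Ordinal (elt j)]; first by rewrite mem_enum.
  by apply: eq_bigr => j _; rewrite ffunE.
- apply: OKD; last by apply: OKM => //; apply: OK_int.
  apply: OKD; first by apply: OKM => //; apply: OK_int.
  apply: OK_sum => j _; apply: OKM; first exact: OK_int.
  by apply/Os/mem_nth; rewrite sk.
have es : \sum_(j < k) (`|e j|%N)%:R * s`_j + p%:R * (\sum_(j < k) (f j)%:~R * s`_j)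
    = - (u%:~R * \sum_(j < k) (c j)%:~R * s`_j).
  rewrite !mulr_sumr -big_split -sumrN; apply: eq_bigr => j _ /=.
  rewrite mulrA -mulrDl mulrA -mulNr; congr (_ * _).
  have /andP[e0 _] := ee j.
  have -> : (`|e j|%N)%:R = (e j)%:~R :> K by rewrite -{2}(gez0_abs e0).
  have -> : - (u%:~R * (c j)%:~R) = (- (u * c j))%:~R :> K by rewrite rmorphN rmorphM.
  by rewrite [in RHS](divz_eq (- (u * c j)) p) [in RHS]intrD [in RHS]intrM addrC [_ * p%:~R]mulrC.
have ex : x = u%:~R * (c k)%:~R * x + w%:~R * p%:R * x.
  by rewrite -mulrDl pmulrn -!intrM -intrD uw mul1r.
have ec : (c k)%:~R * x = p%:R * y - \sum_(j < k) (c j)%:~R * s`_j.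
  by rewrite -cy' addrC addKr.
rewrite {1}ex -mulrA ec.
set r := \sum_(j < k) (`|e j|%N)%:R * s`_j in es *.
set F := \sum_(j < k) (f j)%:~R * s`_j in es *.
have -> : r + p%:R * (u%:~R * y + F + w%:~R * x)
  = (r + p%:R * F) + (u%:~R * (p%:R * y) + w%:~R * p%:R * x) by ring.
by rewrite es; ring.
Qed.

Lemma covers_exists m : (0 < m)%N -> exists s, covers m s.
Proof.
elim/ltn_ind: m => m IH m0; have [m1|m1] := leqP m 1.
  have -> : m = 1%N by lia.
  exists [:: 0]; split; first by move=> r; rewrite inE => /eqP ->; apply: OK0.
  by move=> x Ox; exists 0, x; rewrite inE eqxx mul1r add0r.
have pp := pdiv_prime m1; have /dvdnP[k mk] := pdiv_dvd m.
set p := pdiv m in pp mk; have p1 := prime_gt1 pp.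
have k0 : (0 < k)%N by move: m0; rewrite mk muln_gt0 => /andP[].
have km : (k < m)%N by rewrite mk ltn_Pmulr.
have [s [Os cs]] := covers_prime pp; have [t [Ot ct]] := IH k km k0.
exists [seq a + p%:R * c | a <- s, c <- t]; split.
  move=> _ /allpairsP[[a c] /= [/Os Oa /Ot Oc ->]]; apply: OKD => //.
  by apply: OKM => //; apply: OK_nat.
move=> x /cs[a [y [sa Oy ->]]]; have [c [z [tc Oz ->]]] := ct y Oy.
exists (a + p%:R * c), z; split=> //; first by apply/allpairsP; exists (a, c).
by rewrite mk natrM; ring.
Qed.

End FiniteQuotients.

(** * Finiteness, Nakayama's lemma and invertibility of ideals *)

Section Ideals.
Variable K : fieldExtType rat.
Local Notation OK := (@ring_of_integers K).
Implicit Types I J T : set K.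

Definition OK_module I :=
  [/\ I 0, forall x y, I x -> I y -> I (x + y)
    & forall a x, OK a -> I x -> I (a * x)].

Definition integral_ideal I :=
  [/\ OK_module I, I `<=` OK & exists2 x, I x & x != 0]%classic.

Lemma OK_moduleN I x : OK_module I -> I x -> I (- x).
Proof. by move=> [_ _ IM] Ix; rewrite -mulN1r; apply: IM => //; apply/OKN/OK1. Qed.

Lemma OK_moduleB I x y : OK_module I -> I x -> I y -> I (x - y).
Proof. by move=> mI Ix Iy; case: (mI) => _ ID _; apply: ID => //; apply: OK_moduleN. Qed.

Lemma OK_module_OK : OK_module OK.
Proof. by split; [apply: OK0 | apply: OKD | apply: OKM]. Qed.

Lemma ideal_mul_in I J a c : I a -> J c -> ideal_mul I J (a * c).
Proof.
move=> Ia Jc; exists 1%N, (fun=> a), (fun=> c); split=> //.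
by rewrite big_ord1.
Qed.

Lemma ideal_mul_min I J T : T 0 -> (forall x y, T x -> T y -> T (x + y)) ->
  (forall a c, I a -> J c -> T (a * c)) -> (ideal_mul I J `<=` T)%classic.
Proof.
move=> T0 TD h x [n [a [c [ac ->]]]]; apply: (big_ind T) => // i _.
by have [] := ac i; apply: h.
Qed.

Lemma ideal_mulD I J x y :
  ideal_mul I J x -> ideal_mul I J y -> ideal_mul I J (x + y).
Proof.
move=> [n [a [c [ac ->]]]] [m [a' [c' [ac' ->]]]].
pose f (u : 'I_n -> K) (v : 'I_m -> K) i :=
  match fintype.split i with inl j => u j | inr j => v j end.
exists (n + m)%N, (f a a'), (f c c'); split.
  by move=> i; rewrite /f; case: (fintype.split i).
rewrite big_split_ord /f; congr (_ + _); apply: eq_bigr => i _.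
  by rewrite -[lshift m i]/(unsplit (inl i)) !unsplitK.
by rewrite -[rshift n i]/(unsplit (inr i)) !unsplitK.
Qed.

Lemma ideal_mul0 I J : ideal_mul I J 0.
Proof. by exists 0%N, (fun=> 0), (fun=> 0); split; [case | rewrite big_ord0]. Qed.

Lemma ideal_mulS I J I' J' : (I `<=` I' -> J `<=` J' ->
  ideal_mul I J `<=` ideal_mul I' J')%classic.
Proof.
move=> II' JJ'; apply: ideal_mul_min; [exact: ideal_mul0 | exact: ideal_mulD |].
by move=> a c /II' Ia /JJ' Jc; apply: ideal_mul_in.
Qed.

Lemma ideal_mulC I J : ideal_mul I J = ideal_mul J I.
Proof.
by apply/seteqP; split; apply: ideal_mul_min => [||a c Ia Jc];
  do ?[exact: ideal_mul0 | exact: ideal_mulD | rewrite mulrC; exact: ideal_mul_in].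
Qed.

Lemma ideal_mulA I J T : ideal_mul I (ideal_mul J T) = ideal_mul (ideal_mul I J) T.
Proof.
have h (X Y Z : set K) : (ideal_mul X (ideal_mul Y Z) `<=` ideal_mul (ideal_mul X Y) Z)%classic.
  apply: (@ideal_mul_min X (ideal_mul Y Z) (ideal_mul (ideal_mul X Y) Z));
    [exact: ideal_mul0 | by move=> x y; apply: ideal_mulD | move=> a c Ia].
  move: c; apply: (@ideal_mul_min Y Z (fun c => ideal_mul (ideal_mul X Y) Z (a * c))).
  - by rewrite mulr0; exact: ideal_mul0.
  - by move=> x y hx hy; rewrite mulrDr; apply: ideal_mulD.
  - by move=> c d Yc Zd; rewrite mulrA; do 2?apply: ideal_mul_in.
apply/seteqP; split; first exact: h.
by rewrite ideal_mulC [ideal_mul I J]ideal_mulC [X in (_ `<=` X)%classic]ideal_mulC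
  [ideal_mul J T]ideal_mulC; apply: h.
Qed.

Lemma ideal_mul1 I : OK_module I -> ideal_mul OK I = I.
Proof.
move=> [I0 ID IM]; apply/seteqP; split; first exact: ideal_mul_min.
by move=> x Ix; rewrite -[x]mul1r; apply: ideal_mul_in => //; apply: OK1.
Qed.

Lemma ideal_mul_module I J : OK_module I -> OK_module (ideal_mul I J).
Proof.
move=> [I0 ID IM]; split; [exact: ideal_mul0 | exact: ideal_mulD |].
move=> a x Oa; apply: (@ideal_mul_min I J (fun x => ideal_mul I J (a * x))).
- by rewrite mulr0; exact: ideal_mul0.
- by move=> u v hu hv; rewrite mulrDr; apply: ideal_mulD.
- by move=> u v Iu Jv; rewrite mulrA; apply: ideal_mul_in => //; apply: IM.
Qed.

Lemma integral_idealM I J : integral_ideal I -> integral_ideal J ->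
  integral_ideal (ideal_mul I J).
Proof.
move=> [mI IO [x Ix x0]] [mJ JO [y Jy y0]]; split.
- exact: ideal_mul_module.
- by apply: ideal_mul_min => [||a c /IO Oa /JO Oc]; [apply: OK0 | apply: OKD | apply: OKM].
- by exists (x * y); [apply: ideal_mul_in | rewrite mulf_neq0].
Qed.

Lemma integral_ideal_OK : integral_ideal OK.
Proof. by split=> //; [apply: OK_module_OK | exists 1; [apply: OK1 | apply: oner_neq0]]. Qed.

Lemma integral_ideal_nat I : integral_ideal I -> exists2 m : nat, (0 < m)%N & I m%:R.
Proof.
move=> [[_ _ IM] _ [x Ix x0]]; have [m m0 Om] := OK_multiple x^-1; exists m => //.
by rewrite -[m%:R](mulfVK x0); apply: IM.
Qed.

Lemma natK_gt0 m : (0 < m)%N -> (m%:R : K) != 0.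
Proof. by case: m => // m _; apply: natK_neq0. Qed.

Lemma pigeonhole_mod m (x : nat -> K) : (0 < m)%N -> (forall k, OK (x k)) ->
  exists i j w, [/\ (i < j)%N, OK w & x j - x i = m%:R * w].
Proof.
move=> m0 Ox; have [s [Os cs]] := covers_exists K m0.
have /choice[f fE] k : exists i : 'I_(size s), exists2 w, OK w & x k = s`_i + m%:R * w.
  have [r [w [rs Ow ->]]] := cs (x k) (Ox k).
  by exists (Ordinal (etrans (index_mem r s) rs)), w; rewrite ?nth_index.
pose g (k : 'I_(size s).+1) := f k.
have /injectivePn[i [j ij gij]] : ~~ injectiveb g.
  by apply/injectiveP => /leq_card; rewrite !card_ord ltnn.
have h (a c : 'I_(size s).+1) : f a = f c -> exists2 w, OK w & x a - x c = m%:R * w.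
  move=> e; have [u Ou ->] := fE a; have [v Ov ->] := fE c.
  by exists (u - v); [apply: OKB | rewrite e; ring].
case: (ltngtP i j) => [l|l|/val_inj e]; last by rewrite e eqxx in ij.
- by have [w Ow e] := h j i (esym gij); exists i, j, w.
- by have [w Ow e] := h i j gij; exists j, i, w.
Qed.

(* If [x I] is contained in [I] then the powers of [x] have a common
   denominator [m], and two of them are congruent modulo integers. *)
Lemma module_stabilizer I x : integral_ideal I -> (forall y, I y -> I (x * y)) -> OK x.
Proof.
move=> [_ IO [y Iy y0]] xI; have [m m0 Om] := OK_multiple y^-1.
have Ik k : I (x ^+ k * y).
  by elim: k => [|k IH]; rewrite ?mul1r // exprS -mulrA; apply: xI.
have Ok k : OK (m%:R * x ^+ k).
  have -> : m%:R * x ^+ k = (m%:R * y^-1) * (x ^+ k * y).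
    by rewrite mulrACA mulVf // mulr1.
  by apply: OKM => //; apply: IO.
have [i [j [w [ij Ow e]]]] := pigeonhole_mod m0 Ok.
apply: (OK_monic ij); suff -> : x ^+ j - x ^+ i = w by [].
by apply: (mulfI (natK_gt0 m0)); rewrite -e mulrBr.
Qed.

(** An ideal containing m is determined by the representatives of O_K/m that it contains. As the
    code reflects inclusion, its cardinality also serves as a measure for maximality and
    termination. *)
Lemma finitely_many_ideals m : (0 < m)%N ->
  exists N (enc : set K -> {set 'I_N}), forall I J,
    OK_module I -> I m%:R -> (I `<=` OK)%classic -> OK_module J -> J m%:R ->
    (enc I \subset enc J) <-> (I `<=` J)%classic.
Proof.
move=> m0; have [s [Os cs]] := covers_exists K m0.
exists (size s), (fun I => [set i : 'I_(size s) | `[< I s`_i >]]) => I J mI Im IO mJ Jm.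
split=> [/fintype.subsetP h x Ix|IJ]; last first.
  apply/fintype.subsetP => i; rewrite !finset.in_set => /asboolP h; apply/asboolP; exact: (IJ _ h).
have [r [y [rs Oy xE]]] := cs x (IO x Ix).
have [_ _ IM] := mI; have [_ JD JM] := mJ.
have rsize : (index r s < size s)%N by rewrite index_mem.
have := h (Ordinal rsize); rewrite !finset.in_set /= nth_index // => h'.
rewrite xE; apply: JD; last by rewrite mulrC; apply: JM.
apply/asboolP/h'/asboolP; rewrite -[r](addrK (m%:R * y)) -xE.
by apply: OK_moduleB => //; rewrite mulrC; apply: IM.
Qed.

Definition span I (g : seq K) x :=
  exists2 a : nat -> K, (forall i, I (a i)) & x = \sum_(i < size g) a i * g`_i.

(** The generators are eliminated one at a time. The factor s, congruent to 1 modulo I, lets s x_0 =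
    b_0 x_0 + ... be solved as (s - b_0) x_0 in the span of the others. *)
Lemma nakayama I (g : seq K) s : OK_module I -> (I `<=` OK)%classic -> I (1 - s) ->
  (forall x, x \in g -> span I g (s * x)) ->
  exists2 t, I (1 - t) & forall x, x \in g -> t * x = 0.
Proof.
move=> mI IO; have [I0 ID IM] := mI.
have one_minusM u v : I (1 - u) -> I (1 - v) -> I (1 - u * v).
  move=> Iu Iv; have -> : 1 - u * v = (1 - u) + (1 - v) - (1 - u) * (1 - v) by ring.
  apply: OK_moduleB => //; first exact: ID.
  by apply: IM => //; apply: IO.
elim: g s => [|x0 g IH] s Is sg; first by exists s.
have O_of u : I (1 - u) -> OK u.
  by move=> Iu; rewrite -[u](subKr 1); apply: OKB; [apply: OK1 | apply: IO].
have span0 x : span I (x0 :: g) x -> exists2 a, I a & span I g (x - a * x0).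
  move=> [a Ia ->]; exists (a 0%N) => //; exists (fun i => a i.+1) => //.
  by rewrite big_ord_recl /= addrC addKr.
have spanM a x : OK a -> span I g x -> span I g (a * x).
  move=> Oa [c Ic ->]; exists (fun i => a * c i); first by move=> i; apply: IM.
  by rewrite mulr_sumr; apply: eq_bigr => i _; rewrite mulrA.
have spanD x y : span I g x -> span I g y -> span I g (x + y).
  move=> [c Ic ->] [d Id ->]; exists (fun i => c i + d i); first by move=> i; apply: ID.
  by rewrite -big_split; apply: eq_bigr => i _; rewrite mulrDl.
have [b0 Ib0 sb0] := span0 _ (sg x0 (mem_head _ _)).
pose s1 := s - b0.
have Is1 : I (1 - s1).
  have -> : 1 - s1 = (1 - s) + b0 by rewrite /s1; ring.
  exact: ID.
have s1x0 : span I g (s1 * x0) by rewrite mulrBl.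
have sx x : x \in x0 :: g -> span I g (s1 * s * x).
  move=> /sg /span0[a Ia sa].
  have -> : s1 * s * x = s1 * (s * x - a * x0) + a * (s1 * x0) by ring.
  by apply: spanD; apply: spanM => //; [apply: O_of | apply: IO].
have [||t It tg] := IH (s1 * s); first exact: one_minusM.
  by move=> x xg; apply: sx; apply/predU1P; right.
exists (t * (s1 * s)); first by apply: (one_minusM _ _ It); exact: one_minusM.
have t0 x : span I g x -> t * x = 0.
  move=> [a _ ->]; rewrite mulr_sumr big1 // => i _.
  by rewrite mulrCA tg ?mulr0 // mem_nth.
by move=> x /sx /t0; rewrite mulrA.
Qed.

Lemma nakayama_ideal I J : OK_module I -> (I `<=` OK)%classic -> integral_ideal J ->
  ideal_mul I J = J -> I 1.
Proof.
move=> mI IO iJ IJ; have [mJ JO [z Jz z0]] := iJ; have [_ JD JM] := mJ.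
have [I0 ID IM] := mI.
have [m m0 Jm] := integral_ideal_nat iJ; have [s [Os cs]] := covers_exists K m0.
pose g := m%:R :: [seq r <- s | `[< J r >]].
have gJ r : r \in g -> J r.
  by rewrite in_cons => /orP[/eqP -> //|]; rewrite mem_filter => /andP[/asboolP].
have spanI x : J x -> span I g x.
  rewrite -{1}IJ; apply: ideal_mul_min.
  - by exists (fun=> 0) => //; rewrite big1 // => i _; rewrite mul0r.
  - move=> {}x y [c Ic ->] [d Id ->]; exists (fun i => c i + d i); first by move=> i; apply: ID.
    by rewrite -big_split; apply: eq_bigr => i _; rewrite mulrDl.
  - move=> a y Ia Jy; have [r [w [rs Ow yE]]] := cs y (JO y Jy).
    have rg : r \in [seq r <- s | `[< J r >]].
      rewrite mem_filter rs andbT; apply/asboolP; rewrite -[r](addrK (m%:R * w)) -yE.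
      by apply: OK_moduleB => //; rewrite mulrC; apply: JM.
    set g' := [seq _ <- _ | _] in rg *.
    (* Since y = r + m w, the generator m, at index 0, receives a w, and r, shifted by one in [g],
       receives a. *)
    exists (fun i => (if i == 0%N then a * w else 0) + (if i == (index r g').+1 then a else 0)).
      by move=> i; apply: ID; case: ifP => // _; rewrite mulrC; apply: IM.
    rewrite /g big_ord_recl /= !addr0 yE mulrDr addrC mulrAC mulrA; congr (_ + _).
    rewrite (bigD1 (Ordinal (etrans (index_mem r g') rg))) //= eqxx add0r nth_index //.
    rewrite big1 ?addr0 // => i ni; rewrite eqSS; case: eqP => [e|]; last by rewrite add0r mul0r.
    by case/eqP: ni; apply: val_inj.
have [||t It tg] := nakayama (s := 1) (g := g) mI IO; first by rewrite subrr.
  by move=> x /gJ Jx; rewrite mul1r; apply: spanI.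
have /eqP : t * m%:R = 0 by apply: tg; rewrite mem_head.
rewrite mulf_eq0 (negPf (natK_gt0 m0)) orbF => /eqP t0.
by move: It; rewrite t0 subr0.
Qed.

(** Take c nonzero in I of least absolute norm: t a - c w lies in I and has smaller norm, so it is
    0. The factorial is a common multiple of all the multipliers t. *)
Lemma ideal_hurwitz : exists2 M : nat, (0 < M)%N & forall I, integral_ideal I ->
  exists c, [/\ I c, c != 0 & forall a, I a -> exists2 w, OK w & M%:R * a = c * w].
Proof.
have [M M0 hM] := hurwitz K; exists M`!%N; first exact: fact_gt0.
move=> I iI; have [[I0 ID IM] IO [x Ix x0]] := iI.
pose Q k := `[< exists c, [/\ I c, c != 0 & `|norm c| = k%:R] >].
have normP c : I c -> exists k : nat, `|norm c| = k%:R.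
  move=> /IO /norm_int[z ->]; exists `|z|%N.
  by rewrite -intr_norm -abszE.
have [|k /asboolP[c [Ic c0 ck]] kmin] := @ex_minnP Q.
  by have [k xk] := normP x Ix; exists k; apply/asboolP; exists x.
exists c; split=> // a Ia.
have [t [w [/andP[t0 tM] Ow small]]] := hM (a / c).
have Iy : I (t%:R * a - c * w).
  apply: OK_moduleB => //; first by apply: IM => //; apply: OK_nat.
  by rewrite mulrC; apply: IM.
have y0 : t%:R * a - c * w = 0.
  apply/eqP/negPn/negP => y0; have [l yl] := normP _ Iy.
  have : (k <= l)%N by apply: kmin; apply/asboolP; exists (t%:R * a - c * w).
  rewrite leqNgt => /negP; apply; rewrite -(ltr_nat rat) -yl -ck.
  have -> : t%:R * a - c * w = c * (t%:R * (a / c) - w).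
    by rewrite mulrBr; congr (_ - _); rewrite [RHS]mulrC mulrA divfK.
  by rewrite normM normrM gtr_pMr // normr_gt0 norm_neq0.
have /dvdnP[u uM] : (t %| M`!)%N by apply: dvdn_fact; rewrite t0.
exists (u%:R * w); first by apply: OKM => //; apply: OK_nat.
rewrite uM natrM -mulrA; move/eqP: y0; rewrite subr_eq0 => /eqP ->.
by ring.
Qed.

Definition ideal_pow I k := iter k (ideal_mul I) OK.

Lemma integral_ideal_pow I k : integral_ideal I -> integral_ideal (ideal_pow I k).
Proof.
move=> iI; elim: k => [|k IH]; first exact: integral_ideal_OK.
exact: integral_idealM.
Qed.

Lemma ideal_powD I k l : integral_ideal I ->
  ideal_pow I (k + l) = ideal_mul (ideal_pow I k) (ideal_pow I l).
Proof.
move=> iI; elim: k => [|k IH]; last by rewrite addSn /= IH ideal_mulA.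
by rewrite add0n ideal_mul1 //; case: (integral_ideal_pow l iI).
Qed.

(* Two powers of [I] are equivalent by finiteness of the class number, hence some
   power of [I] is principal by Nakayama's lemma. *)
Lemma ideal_invertible I : integral_ideal I -> ideal_mul I (ideal_inv I) 1.
Proof.
move=> iI; have [M M0 hM] := ideal_hurwitz.
have M0K := natK_gt0 M0.
have /choice[c cP] k := hM _ (integral_ideal_pow k iI).
have [N [enc encP]] := finitely_many_ideals M0.
(* The ideal (M / c_k) I^k is integral and contains M, so there are finitely many possibilities. *)
pose J k : set K := fun x => ideal_pow I k (c k * x / M%:R).
have iJ k : [/\ OK_module (J k), J k M%:R & (J k `<=` OK)%classic].
  have [Ic c0 cI] := cP k; have [[P0 PD PM] PO _] := integral_ideal_pow k iI; split.
  - split; first by rewrite /J mulr0 mul0r.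
    + by move=> x y Jx Jy; rewrite /J mulrDr mulrDl; apply: PD.
    + move=> a x Oa Jx; rewrite /J.
      have -> : c k * (a * x) / M%:R = a * (c k * x / M%:R) by ring.
      exact: PM.
  - by rewrite /J mulfK.
  - move=> x /cI[w Ow]; rewrite mulrC divfK // => /(mulfI c0) -> //.
pose e (k : 'I_(#|{set 'I_N}|).+1) := enc (J k).
have /injectivePn[k1 [k2 k12 ek]] : ~~ injectiveb e.
  by apply/injectiveP => /leq_card; rewrite card_ord ltnn.
have JE (a d : 'I_(#|{set 'I_N}|).+1) : enc (J a) = enc (J d) -> J a = J d.
  move=> ead; have [m1 M1 O1] := iJ a; have [m2 M2 O2] := iJ d.
  by apply/seteqP; split; apply/encP => //; rewrite ead.
have [i [j [ij JJ]]] : exists i j : nat, (i < j)%N /\ J i = J j.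
  case: (ltngtP k1 k2) => [l|l|/val_inj E]; last by rewrite E eqxx in k12.
    by exists k1, k2; split=> //; apply: JE.
  by exists k2, k1; split=> //; apply/esym/JE.
have [Ii ci0 _] := cP i; have [Ij cj0 _] := cP j.
pose r := c j / c i; have r0 : r != 0 by rewrite mulf_neq0 ?invr_eq0.
have powE x : ideal_pow I j (r * x) <-> ideal_pow I i x.
  have h k y : ideal_pow I k y <-> J k (M%:R * y / c k).
    have [_ c0 _] := cP k; rewrite /J.
    by rewrite (_ : c k * _ / _ = y) //; field; rewrite c0 M0K.
  rewrite !h -JJ (_ : M%:R * (r * x) / c j = M%:R * x / c i) //.
  by rewrite /r; field; rewrite ci0 cj0.
have ji : j = ((j - i) + i)%N by rewrite subnK // ltnW.
(* From I^j = r I^i the fractional ideal B = r^-1 I^(j-i) fixes A = I^i; hence B lies in O_K and, by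
   Nakayama, contains 1, so r belongs to I^(j-i). *)
pose A := ideal_pow I i; pose B : set K := fun x => ideal_pow I (j - i) (r * x).
have iA : integral_ideal A by apply: integral_ideal_pow.
have [mA AO _] := iA; have [A0 AD AM] := mA.
have [[B0 BD BM] BO _] := integral_ideal_pow (j - i) iI.
have BA : ideal_mul B A = A.
  apply/seteqP; split.
    apply: ideal_mul_min => // x y Bx Ay; apply/powE.
    by rewrite ji ideal_powD // mulrA; apply: ideal_mul_in.
  move=> x /powE; rewrite ji ideal_powD // => hx.
  have -> : x = r^-1 * (r * x) by rewrite mulKf.
  move: (r * x) hx; apply: (@ideal_mul_min _ _ (fun z => ideal_mul B A (r^-1 * z))).
  - by rewrite mulr0; exact: ideal_mul0.
  - by move=> u v hu hv; rewrite mulrDr; apply: ideal_mulD.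
  - move=> u v Bu Av; rewrite mulrA; apply: ideal_mul_in => //.
    by rewrite /B mulrA mulfV // mul1r.
have mB : OK_module B.
  split; first by rewrite /B mulr0.
  + by move=> x y Bx By; rewrite /B mulrDr; apply: BD.
  + by move=> a x Oa Bx; rewrite /B mulrCA; apply: BM.
have BOK : (B `<=` OK)%classic.
  move=> x Bx; apply: (module_stabilizer iA) => y Ay.
  by rewrite -BA; apply: ideal_mul_in.
have B1 : B 1 := nakayama_ideal mB BOK iA BA.
rewrite /B mulr1 in B1.
have jiS : (j - i = (j - i).-1.+1)%N by rewrite prednK // subn_gt0.
rewrite -[1](mulVf r0); move: B1; rewrite jiS /=.
(* Thus r^-1 I^(j-i-1) is contained in the inverse of I, and splitting r as an element of I
   I^(j-i-1) writes 1 as required. *)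
have rB x y : ideal_pow I (j - i).-1 y -> I x -> OK (r^-1 * (x * y)).
  move=> Py Ix; apply: BOK; rewrite /B mulrA mulfV // mul1r jiS /=.
  exact: ideal_mul_in.
move: {-2}r => z; move: z.
apply: (@ideal_mul_min _ _ (fun z => ideal_mul I (ideal_inv I) (r^-1 * z))).
- by rewrite mulr0; exact: ideal_mul0.
- by move=> u v hu hv; rewrite mulrDr; apply: ideal_mulD.
- move=> u v Iu Pv; rewrite mulrCA; apply: ideal_mul_in => // y Iy.
  by rewrite -mulrA [v * y]mulrC; apply: rB.
Qed.

End Ideals.

(** * Fractional ideals and unique factorisation *)

Section FractionalIdealGroup.
Variable K : fieldExtType rat.
Local Notation OK := (@ring_of_integers K).
Implicit Types I J : set K.

Definition invertible I := OK_module I /\ ideal_mul I (ideal_inv I) = OK.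

(* The group of fractional ideals, written additively. *)
Record fracideal := FracIdeal { fracideal_set :> set K; _ : `[< invertible fracideal_set >] }.
HB.instance Definition _ := [isSub for fracideal_set].
HB.instance Definition _ := [Choice of fracideal by <:].

Lemma fracidealP (I : fracideal) : invertible I.
Proof. by case: I => I /= /asboolP. Qed.

Lemma invertible_witness I J : OK_module I -> ideal_mul I J 1 ->
  (ideal_mul I J `<=` OK)%classic -> invertible I.
Proof.
move=> mI IJ1 IJO; split=> //; apply/seteqP; split.
  apply: ideal_mul_min => [||a c Ia ic]; [exact: OK0 | exact: OKD |].
  by rewrite mulrC; apply: ic.
move=> x Ox; rewrite -[x]mulr1; have [_ _] := ideal_mul_module (ideal_inv I) mI.
apply=> //; apply: (@ideal_mulS _ I J I (ideal_inv I)) IJ1 => // c Jc a Ia.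
by rewrite mulrC; apply/IJO/ideal_mul_in.
Qed.

Lemma inv_module I : OK_module (ideal_inv I).
Proof.
split; first by move=> y _; rewrite mul0r; apply: OK0.
- by move=> x y ix iy z Iz; rewrite mulrDl; apply: OKD; [apply: ix | apply: iy].
- by move=> a x Oa ix z Iz; rewrite -mulrA; apply: OKM => //; apply: ix.
Qed.

Lemma invertible_OK : invertible OK.
Proof.
apply: (@invertible_witness OK OK); first exact: OK_module_OK.
  by rewrite -[1]mulr1; apply: ideal_mul_in; apply: OK1.
by rewrite (ideal_mul1 (OK_module_OK K)).
Qed.

Lemma invertible_mul I J : invertible I -> invertible J -> invertible (ideal_mul I J).
Proof.
move=> [mI eI] [mJ eJ].
have e : ideal_mul (ideal_mul I J) (ideal_mul (ideal_inv I) (ideal_inv J)) = OK.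
  rewrite [ideal_mul (ideal_inv I) _]ideal_mulC ideal_mulA -[X in ideal_mul X _]ideal_mulA eJ.
  by rewrite [ideal_mul I OK]ideal_mulC (ideal_mul1 mI).
apply: (@invertible_witness _ (ideal_mul (ideal_inv I) (ideal_inv J))).
- exact: ideal_mul_module.
- by rewrite e; apply: OK1.
- by rewrite e.
Qed.

Lemma invertible_inv I : invertible I -> invertible (ideal_inv I).
Proof.
move=> [mI eI]; apply: (@invertible_witness _ I); first exact: inv_module.
  by rewrite ideal_mulC eI; apply: OK1.
by rewrite ideal_mulC eI.
Qed.

Definition frac0 := FracIdeal (asboolT invertible_OK).
Definition fracD (I J : fracideal) :=
  FracIdeal (asboolT (invertible_mul (fracidealP I) (fracidealP J))).
Definition fracN (I : fracideal) := FracIdeal (asboolT (invertible_inv (fracidealP I))).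

Lemma fracDA : associative fracD.
Proof. by move=> I J L; apply: val_inj; apply: ideal_mulA. Qed.
Lemma fracDC : commutative fracD.
Proof. by move=> I J; apply: val_inj; apply: ideal_mulC. Qed.
Lemma frac0D : left_id frac0 fracD.
Proof. by move=> I; apply: val_inj; apply: ideal_mul1; case: (fracidealP I). Qed.
Lemma fracND : left_inverse frac0 fracN fracD.
Proof. by move=> I; apply: val_inj; rewrite /= ideal_mulC; case: (fracidealP I). Qed.

HB.instance Definition _ := GRing.isZmodule.Build fracideal fracDA fracDC frac0D fracND.

Lemma fracideal_exp (I : fracideal) (m : int) : (I *~ m : fracideal) = ideal_exp I m :> set K.
Proof.
have h (J : fracideal) k : (J *+ k : fracideal) = iter k (ideal_mul J) OK :> set K.
  by elim: k => [//|k IH]; rewrite mulrS /= -IH.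
case: m => k; first exact: h.
by rewrite NegzE mulrNz -mulNrz; apply: h.
Qed.

Lemma prime_ideal_integral (p : prime_ideals K) : integral_ideal (val p).
Proof.
case: p => p /= /asboolP[pO [p0 pD] pM [_ [x px x0]] _].
by split=> //; exists x.
Qed.

Lemma integral_invertible I : integral_ideal I -> invertible I.
Proof.
move=> iI; have [mI IO _] := iI; apply: (@invertible_witness _ (ideal_inv I)) => //.
  exact: ideal_invertible.
apply: ideal_mul_min => [||a c Ia ic]; [exact: OK0 | exact: OKD |].
by rewrite mulrC; apply: ic.
Qed.

Definition frac_prime (p : prime_ideals K) : fracideal :=
  FracIdeal (asboolT (integral_invertible (prime_ideal_integral p))).

Lemma prime_not1 (p : prime_ideals K) : ~ val p 1.
Proof. by case: p => p /= /asboolP[_ _ _ []]. Qed.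

Lemma prime_mul (p : prime_ideals K) x y : OK x -> OK y -> val p (x * y) ->
  val p x \/ val p y.
Proof. by case: p => p /= /asboolP[_ _ _ _]; apply. Qed.

Lemma prime_exp (p : prime_ideals K) x k : OK x -> val p (x ^+ k) -> val p x.
Proof.
move=> Ox; elim: k => [/prime_not1 //|k IH]; rewrite exprS.
by case/(prime_mul Ox (OKX k Ox)).
Qed.

(* Modulo a prime every nonzero residue is a root of unity, by pigeonhole. *)
Lemma prime_maximal (p : prime_ideals K) x : OK x -> ~ val p x ->
  exists2 y, OK y & val p (1 - x * y).
Proof.
move=> Ox px; have iP := prime_ideal_integral p; have [[_ _ pM] pO _] := iP.
have [m m0 pm] := integral_ideal_nat iP.
have [i [j [w [ij Ow e]]]] := pigeonhole_mod m0 (fun k => OKX k Ox).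
have : val p (x ^+ i * (x ^+ (j - i) - 1)).
  rewrite mulrBr mulr1 -exprD subnKC 1?ltnW // e mulrC; exact: pM.
have Oj : OK (x ^+ (j - i) - 1) by apply: OKB; [apply: OKX | apply: OK1].
case/(prime_mul (OKX i Ox) Oj) => [/(prime_exp Ox) //|h].
exists (x ^+ (j - i).-1); first exact: OKX.
rewrite -exprS prednK ?subn_gt0 // -opprB.
by apply: OK_moduleN => //; case: iP.
Qed.

Lemma prime_sub_eq (p q : prime_ideals K) : (val p `<=` val q)%classic -> p = q.
Proof.
move=> pq; apply: val_inj; apply/seteqP; split=> // x qx.
have [mq qO _] := prime_ideal_integral q; have [_ qD qM] := mq.
apply: contrapT => px; have [y Oy /pq qy] := prime_maximal (qO x qx) px.
case: (@prime_not1 q); rewrite -[1](subrK (x * y)); apply: qD => //.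
by rewrite mulrC; apply: qM.
Qed.

Lemma frac_sum_integral (l : seq (prime_ideals K)) :
  integral_ideal (\sum_(p <- l) frac_prime p : fracideal).
Proof.
elim: l => [|p l IH]; first by rewrite big_nil; apply: integral_ideal_OK.
by rewrite big_cons; apply: integral_idealM => //; apply: prime_ideal_integral.
Qed.

Lemma frac_sum_sub (l : seq (prime_ideals K)) p : p \in l ->
  ((\sum_(p <- l) frac_prime p : fracideal) `<=` val p)%classic.
Proof.
move=> pl; rewrite (big_rem p) //=; have [[p0 pD pM] _ _] := prime_ideal_integral p.
have [_ sO _] := frac_sum_integral (rem p l).
apply: ideal_mul_min => // a c pa /sO Oc; rewrite mulrC; exact: pM.
Qed.

Lemma prime_contains_sum (l : seq (prime_ideals K)) q :
  ((\sum_(p <- l) frac_prime p : fracideal) `<=` val q)%classic -> q \in l.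
Proof.
elim: l => [|p l IH]; first by rewrite big_nil => /(_ 1 (OK1 K)) /prime_not1.
rewrite big_cons in_cons => h; have [->|qp] := eqVneq q p => //=; apply: IH.
have : ~ (val p `<=` val q)%classic by move=> /prime_sub_eq e; rewrite e eqxx in qp.
move=> /existsNP[x /not_implyP[px nqx]] y sy.
have [_ pO _] := prime_ideal_integral p; have [_ sO _] := frac_sum_integral l.
have : val q (x * y) by apply: h; apply: ideal_mul_in.
by case/(prime_mul (pO x px) (sO y sy)).
Qed.

(** A prime containing a product of primes is one of the factors; it is then cancelled in the
    group. *)
Lemma frac_sum_perm (l l' : seq (prime_ideals K)) :
  \sum_(p <- l) frac_prime p = \sum_(p <- l') frac_prime p -> perm_eq l l'.
Proof.
elim: l l' => [|p l IH] l' e.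
  case: l' e => // q l' e.
  have : q \in [::] by apply: prime_contains_sum; rewrite e; apply: frac_sum_sub (mem_head _ _).
  by [].
have pl : p \in l'.
  by apply: prime_contains_sum; rewrite -e; apply: frac_sum_sub (mem_head _ _).
rewrite perm_sym (perm_trans (perm_to_rem pl)) // perm_cons perm_sym; apply: IH.
by move: e; rewrite big_cons (big_rem p pl) /= => /addrI.
Qed.

Section Exponents.
Implicit Types (v w : {fsfun prime_ideals K -> int with 0}).

Definition weighted_sum (V : zmodType) (f : prime_ideals K -> V) v : V :=
  \sum_(q <- finsupp v) f q *~ v q.

Lemma weighted_sum_widen (V : zmodType) (f : prime_ideals K -> V) v (X : {fset prime_ideals K}) :
  (finsupp v `<=` X)%fset -> weighted_sum f v = \sum_(q <- X) f q *~ v q.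
Proof.
by move=> vX; apply: big_fset_incl => // q _ /fsfun_dflt ->; rewrite mulr0z.
Qed.

Lemma fracideal_prod v :
  \big[@ideal_mul K/OK]_(q <- finsupp v) ideal_exp (val q) (v q)
   = (weighted_sum frac_prime v : fracideal).
Proof.
rewrite /weighted_sum; elim: (enum_fset (finsupp v)) => [|q s IH]; first by rewrite !big_nil.
by rewrite !big_cons IH -(fracideal_exp (frac_prime q)).
Qed.

(** Negative exponents are moved to the other side: the positive parts of v - w and w - v give two
    equal products of primes, to which [frac_sum_perm] applies. *)
Lemma weighted_sum_inj v w :
  weighted_sum frac_prime v = weighted_sum frac_prime w -> v = w.
Proof.
pose X := (finsupp v `|` finsupp w)%fset.
rewrite (@weighted_sum_widen _ _ v X) ?fsubsetUl //.
rewrite (@weighted_sum_widen _ _ w X) ?fsubsetUr // => e.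
pose P (a : prime_ideals K -> int) :=
  flatten [seq nseq `|Num.max (a q) 0|%N q | q <- X].
have PE a : \sum_(p <- P a) frac_prime p = \sum_(q <- X) frac_prime q *~ Num.max (a q) 0.
  rewrite /P big_flatten big_map; apply: eq_bigr => q _.
  rewrite big_nseq iter_addr_0 -{2}(gez0_abs (_ : 0 <= Num.max (a q) 0)) //.
  by rewrite le_max lexx orbT.
pose d q := v q - w q; pose d' q := w q - v q.
have /frac_sum_perm/seq.permP pd : \sum_(p <- P d) frac_prime p = \sum_(p <- P d') frac_prime p.
  rewrite !PE; apply/eqP; rewrite -subr_eq0 -sumrB.
  have h0 : \sum_(q <- X) frac_prime q *~ v q - \sum_(q <- X) frac_prime q *~ w q = 0.
    by rewrite e subrr.
  apply/eqP; apply: etrans h0; rewrite -sumrB.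
  apply: eq_bigr => q _; rewrite -!mulrzBr; congr (_ *~ _).
  by rewrite /d /d'; case: (leP (v q - w q) 0); case: (leP (w q - v q) 0); lia.
have cP a q : q \in X -> count_mem q (P a) = `|Num.max (a q) 0|%N.
  move=> qX; rewrite /P count_flatten -map_comp sumnE big_map.
  rewrite (big_fsetD1 q) //= count_nseq /= eqxx mul1n big_seq big1 ?addn0 // => r.
  by rewrite !inE => /andP[rq _]; rewrite count_nseq /= (negPf rq).
apply/fsfunP => q; have [qX|] := boolP (q \in X).
  have := pd (pred1 q); rewrite !cP // /d /d'.
  by case: (leP (v q - w q) 0); case: (leP (w q - v q) 0); lia.
by rewrite in_fsetU negb_or => /andP[/fsfun_dflt -> /fsfun_dflt ->].
Qed.

(** Uniqueness of exponents makes the chosen factorisation equal to any given one. *)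
Lemma valuationsE (I : fracideal) v : weighted_sum frac_prime v = I ->
  valuations I = v.
Proof.
move=> e; rewrite /valuations; case: xgetP => [w _ /= ew|/(_ v) []]; last first.
  by rewrite /= fracideal_prod e.
by apply: weighted_sum_inj; apply: val_inj; rewrite /= -fracideal_prod -ew e.
Qed.

Definition multiplicities (l : seq (prime_ideals K)) : {fsfun prime_ideals K -> int with 0} :=
  [fsfun q in seq_fset tt l => (count_mem q l)%:Z].

Lemma weighted_sum_multiplicities (V : zmodType) (f : prime_ideals K -> V) l :
  weighted_sum f (multiplicities l) = \sum_(p <- l) f p.
Proof.
have vE q : multiplicities l q = (count_mem q l)%:Z.
  rewrite fsfunE seq_fsetE; case: ifP => // /negbT ql.
  by rewrite (count_memPn ql).
rewrite (@weighted_sum_widen _ _ _ (seq_fset tt l)); last first.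
  by apply/fsubsetP => q; rewrite mem_finsupp vE seq_fsetE -has_pred1 has_count; case: count.
under eq_bigr => q _ do rewrite vE.
rewrite (perm_big _ (seq_fset_perm tt l)) /=.
rewrite -[RHS]big_undup_iterop_count /=; apply: eq_bigr => q _.
by rewrite Monoid.iteropE iter_addr_0.
Qed.

End Exponents.

(** A proper ideal above I whose code is largest is maximal, hence prime. *)
Lemma prime_containing m I : (0 < m)%N -> OK_module I -> (I `<=` OK)%classic ->
  I m%:R -> ~ I 1 -> exists p : prime_ideals K, (I `<=` val p)%classic.
Proof.
move=> m0 mI IO Im I1; have [N [enc encP]] := finitely_many_ideals K m0.
pose Q k := `[< exists J : set K, [/\ OK_module J, (J `<=` OK)%classic, J m%:R,
   ~ J 1 /\ (I `<=` J)%classic & #|enc J| = k] >].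
have [||k /asboolP[J [mJ JO Jm [J1 IJ] Jk]] kmax] := @ex_maxnP Q N.
- by exists #|enc I|; apply/asboolP; exists I; split=> //; split.
- by move=> k /asboolP[J [_ _ _ _ <-]]; rewrite (leq_trans (max_card _)) ?card_ord.
have [J0 JD JM] := mJ.
suff pJ : prime_ideal J by exists (exist _ J (asboolT pJ)).
split; [exact: JO | by split | exact: JM |
  by split=> //; exists m%:R; rewrite ?natK_gt0 |].
move=> x y Ox Oy Jxy; have [Jx|nJx] := pselect (J x); [by left | right].
pose J' : set K := fun z => exists2 a, OK a & J (z - a * x).
have JJ' : (J `<=` J')%classic.
  by move=> z Jz; exists 0; rewrite ?mul0r ?subr0 //; apply: OK0.
have mJ' : OK_module J'.
  split; first exact: JJ'.
  - move=> z t [a Oa ha] [c Oc hc]; exists (a + c); first exact: OKD.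
    have -> : z + t - (a + c) * x = (z - a * x) + (t - c * x) by ring.
    exact: JD.
  - move=> c z Oc [a Oa ha]; exists (c * a); first exact: OKM.
    have -> : c * z - c * a * x = c * (z - a * x) by ring.
    exact: JM.
have J'O : (J' `<=` OK)%classic.
  move=> z [a Oa /JO h]; rewrite -[z](subrK (a * x)); apply: OKD => //; exact: OKM.
have [[a Oa ha]|nJ'1] := pselect (J' 1).
  have -> : y = y * (1 - a * x) + a * (x * y) by ring.
  by apply: JD; apply: JM.
have J'x : J' x by exists 1; rewrite ?mul1r ?subrr //; apply: OK1.
have : (#|enc J'| <= k)%N.
  apply: kmax; apply/asboolP; exists J'; split=> //; first exact: JJ'.
  by split=> // z /IJ /JJ'.
rewrite leqNgt -Jk => /negP[]; apply: proper_card; apply/andP; split.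
  by apply/encP => //; apply: JJ'.
by apply/negP => /encP h; apply: nJx; apply: h => //; apply: JJ'.
Qed.

Lemma fracideal_factorization m (I : fracideal) : (0 < m)%N ->
  (I `<=` OK)%classic -> fracideal_set I m%:R ->
  exists2 l, I = \sum_(p <- l) frac_prime p & forall p, p \in l -> val p m%:R.
Proof.
move=> m0; have [N [enc encP]] := finitely_many_ideals K m0.
have [k] := ubnP (N - #|enc I|)%N; elim: k I => // k IH I Ik IO Im.
have [mI _] := fracidealP I.
have [I1|I1] := pselect (fracideal_set I 1).
  exists [::] => //; rewrite big_nil; apply: val_inj; apply/seteqP; split=> //= x Ox.
  by rewrite -[x]mulr1; case: mI => _ _; apply.
have [p Ip] := prime_containing m0 mI IO Im I1.
have [[mp ep] pi] := (fracidealP (frac_prime p), prime_ideal_integral p).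
pose J : fracideal := I - frac_prime p.
have IJ : I = frac_prime p + J by rewrite addrC subrK.
have p1 : ideal_inv (val p) 1.
  by move=> y py; rewrite mul1r; case: pi => _ pO _; apply: pO.
have JO : (J `<=` OK)%classic.
  rewrite -[X in (_ `<=` X)%classic]ep; apply: ideal_mulS => //.
have sIJ : (I `<=` J)%classic.
  by move=> x Ix; rewrite -[x]mulr1; apply: ideal_mul_in.
have [mJ _] := fracidealP J.
have lt : (#|enc I| < #|enc J|)%N.
  (* If J = p^-1 I were contained in I, then p^-1 would stabilise I, hence lie in O_K, and p p^-1 =
     O_K would be contained in p. *)
  apply: proper_card; apply/andP; split; first by apply/encP => //; apply: sIJ.
  apply/negP => /encP h; apply: (@prime_not1 p).
  have iI : integral_ideal I by split=> //; exists m%:R; rewrite ?natK_gt0.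
  have invO : (ideal_inv (val p) `<=` OK)%classic.
    move=> y iy; apply: (module_stabilizer iI) => z Iz; apply: h => //; first exact: sIJ.
    by rewrite mulrC; apply: ideal_mul_in.
  have : ideal_mul (val p) (ideal_inv (val p)) 1 by rewrite ep; apply: OK1.
  have [p0 pD pM] := mp.
  by apply: ideal_mul_min => // a c pa /invO Oc; rewrite mulrC; apply: pM.
have cN : (#|enc J| <= N)%N by rewrite (leq_trans (max_card _)) ?card_ord.
have [|||l Jl lm] := IH J; [lia | exact: JO | exact: sIJ |].
exists (p :: l); first by rewrite big_cons -Jl.
by move=> q; rewrite in_cons => /orP[/eqP ->|/lm //]; apply: Ip.
Qed.

Lemma principal_invertible (c : K) : c != 0 -> invertible (principal c).
Proof.
move=> c0; apply: (@invertible_witness _ (principal c^-1)).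
- split; first by exists 0; [apply: OK0 | rewrite mulr0].
  + by move=> _ _ [x Ox <-] [y Oy <-]; exists (x + y); [apply: OKD | rewrite mulrDr].
  + by move=> a _ Oa [x Ox <-]; exists (a * x); [apply: OKM | rewrite mulrCA].
- by rewrite -(mulfV c0); apply: ideal_mul_in; exists 1; rewrite ?mulr1 //; apply: OK1.
- apply: ideal_mul_min; [exact: OK0 | exact: OKD |] => _ _ [x Ox <-] [y Oy <-].
  by rewrite mulrACA mulfV // mul1r; apply: OKM.
Qed.

Lemma finitely_many_primes m : (0 < m)%N ->
  exists s : seq (prime_ideals K), forall p : prime_ideals K, val p m%:R -> p \in s.
Proof.
move=> m0; have [N [enc encP]] := finitely_many_ideals K m0.
pose pick (T : {set 'I_N}) : option (prime_ideals K) :=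
  if pselect (exists p : prime_ideals K, val p m%:R /\ enc (val p) = T) is left h
  then Some (sval (cid h)) else None.
exists (pmap pick (enum {set 'I_N})) => p pm.
rewrite mem_pmap; apply/mapP; exists (enc (val p)); first by rewrite mem_enum.
rewrite /pick; case: pselect => [h|[]]; last by exists p.
congr Some; case: (cid h) => q /= [qm qp]; apply: prime_sub_eq.
have [mp pO _] := prime_ideal_integral p; have [mq qO _] := prime_ideal_integral q.
by apply/encP => //; rewrite qp.
Qed.

Lemma class_group_generated : exists s : seq (prime_ideals K), forall q,
  exists c l, [/\ c != 0, {subset l <= s} &
    valuations (principal c) = multiplicities (q :: l)].
Proof.
have [M M0 hM] := ideal_hurwitz K; have [s sP] := finitely_many_primes M0.
exists s => q; have [c [qc c0 cM]] := hM _ (prime_ideal_integral q).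
pose P : fracideal := FracIdeal (asboolT (principal_invertible c0)).
pose J : fracideal := P - frac_prime q.
have JO : (J `<=` OK)%classic.
  apply: ideal_mul_min; [exact: OK0 | exact: OKD |] => _ y [x Ox <-] iy.
  by rewrite mulrAC mulrC; apply: OKM => //; rewrite mulrC; apply: iy.
(* By the choice of c, the quotient M / c multiplies q into O_K. *)
have JM : fracideal_set J M%:R.
  have -> : (M%:R : K) = c * (M%:R / c) by rewrite mulrC divfK.
  apply: ideal_mul_in; first by exists 1; rewrite ?mulr1 //; apply: OK1.
  move=> y /cM[w Ow e].
  by rewrite mulrAC e mulrC mulKf.
have [l Jl lM] := fracideal_factorization M0 JO JM.
exists c, l; split=> //; first by move=> p /lM /sP.
apply: (@valuationsE P); rewrite weighted_sum_multiplicities big_cons -Jl.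
by rewrite addrC subrK.
Qed.

End FractionalIdealGroup.

(** The first clause makes [class_h] the structure induced from A_K, independent of representatives,
    so that finite generation in the second refers to the intended operations. *)
Theorem proposition2p24 (K : fieldExtType rat) :
  (forall (r : nat) (F : AK K),
     class_h r (class_pi F) = class_pi (plethysm_h r F)) /\
  finitely_generated_lambda (@class_h K).
Proof.
split; first exact: class_hE.
have [s sP] := class_group_generated K; apply: (@class_ring_generated _ s) => q.
have [c [l [c0 ls e]]] := sP q; exists l => //; exists c => //.
by rewrite e [RHS]weighted_sum_multiplicities big_cons.
Qed.
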